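(* Let $F$ be a field of characteristic $\ell\neq 2$, let $V$ be a non-zero finite dimensional vector space over $F$, and let $f:V\times V\to F$ be a bilinear form. Then $L(f)$ is reductive if and only if either $f=0$, in which case $L(f)\cong\mathfrak{gl}(n,F)$ for $n=\dim(V)$, or else $V_{\mathrm{odd}}=0$ and $L(f_{\mathrm{even}})$, $L(f_{\mathrm{ndeg}})$ are both reductive. Moreover, in the latter case $L(f)\cong L(f_{\mathrm{even}})\oplus L(f_{\mathrm{ndeg}})$.
   Context: For a bilinear form $g$ on a finite dimensional space $W$, $L(g)=\{x\in\mathfrak{gl}(W)\mid g(xv,w)=-g(v,xw)\ \text{for all } v,w\in W\}$ (which is $0$ if $W=0$). A Lie algebra is called reductive if every solvable ideal is central. $V=U_1\perp\cdots\perp U_m$ means $V=U_1\oplus\cdots\oplus U_m$ and $f(U_i,U_j)=0$ for all $i\neq j$. A form on a non-zero space is indecomposable if the space admits no such decomposition into two non-zero subspaces. Write $V=U_1\perp\cdots\perp U_m$ with each restriction $f_{U_i}$ indecomposable. $J_n$ is the $n\times n$ lower triangular nilpotent Jordan block. $V_{\mathrm{even}}$ (resp. $V_{\mathrm{odd}}$) is the sum of all $U_i$ such that $f_{U_i}$ has Gram matrix $J_n$, in some basis, with $n$ even (resp. odd), and $V_{\mathrm{ndeg}}$ is the sum of all other $U_i$. The restrictions of $f$ to these subspaces are denoted $f_{\mathrm{even}},f_{\mathrm{odd}},f_{\mathrm{ndeg}}$; the form $f_{\mathrm{ndeg}}$ is non-degenerate, and the equivalence types of these three forms are determined by $f$ (independently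 of the chosen decomposition). *)

(* Defs.v *)
From HB Require Import structures.
From mathcomp Require Import all_boot all_order all_algebra.
From mathcomp Require Import boolp.

Set Implicit Arguments.
Unset Strict Implicit.
Unset Printing Implicit Defensive.

Import GRing.Theory.
Local Open Scope ring_scope.

HB.mixin Record hasLieBracket (F : fieldType) L of Vector F L := {
  lie : L -> L -> L;
  lie_bilinear : bilinear_for *:%R *:%R lie;
  liexx : forall x, lie x x = 0;
  lie_jacobi : forall x y z,
    lie x (lie y z) + lie y (lie z x) + lie z (lie x y) = 0
}.

#[short(type="lieAlgType")]
HB.structure Definition LieAlgebra (F : fieldType) :=
  { L of hasLieBracket F L & Vector F L }.

Section LieTheory.
Variables (F : fieldType) (L : lieAlgType F).
Implicit Types A B I : {vspace L}.

Definition lie_ideal I : Prop :=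
  forall x y : L, y \in I -> lie x y \in I.

(* [A, B], the span of all brackets; by bilinearity bases suffice *)
Definition lie_prod A B : {vspace L} :=
  <<[seq lie x y | x <- vbasis A, y <- vbasis B]>>%VS.

Definition derived_series A (k : nat) : {vspace L} :=
  iter k (fun B => lie_prod B B) A.

Definition lie_solvable A : Prop := exists k, derived_series A k = 0%VS.

Definition lie_central A : Prop :=
  forall x y : L, x \in A -> lie x y = 0.

Definition reductive : Prop :=
  forall I, lie_ideal I -> lie_solvable I -> lie_central I.

HB.instance Definition _ :=
  bilinear_isBilinear.Build F L L L *:%R *:%R (@lie F L) lie_bilinear.

Lemma memv_lie A B x y : x \in A -> y \in B -> lie x y \in lie_prod A B.
Proof.
move=> xA yB; rewrite (coord_vbasis xA) (coord_vbasis yB).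
rewrite linear_sumlz; apply: memv_suml => i _.
rewrite linear_sumr; apply: memv_suml => j _.
rewrite linearZl_LR linearZr_LR !memvZ //.
by apply/memv_span/allpairsP; exists ((vbasis A)`_i, (vbasis B)`_j);
  rewrite !mem_nth ?size_tuple.
Qed.

End LieTheory.

Definition lie_isomorphic (F : fieldType) (L1 L2 : lieAlgType F) : Prop :=
  exists phi : {linear L1 -> L2},
    bijective phi /\ {morph phi : x y / lie x y}.

Fact commutator_jacobi (M : zmodType) (a b c d e g : M) :
  (a - b - (c - d)) + (c - e - (g - b)) + (g - d - (a - e)) = 0.
Proof.
rewrite !opprB !addrA.
rewrite [LHS](ACl ((1*12)*(7*2)*(3*10)*(5*4)*(11*6)*(9*8))) /=.
by rewrite !subrr !addr0.
Qed.

Section LieSum.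
Variables (F : fieldType) (L1 L2 : lieAlgType F).

Definition pair_lie (x y : L1 * L2) : L1 * L2 := (lie x.1 y.1, lie x.2 y.2).

Fact pair_lie_bilinear : bilinear_for *:%R *:%R pair_lie.
Proof.
split=> z a x y; congr pair.
- exact: (lie_bilinear (s := L1)).1.
- exact: (lie_bilinear (s := L2)).1.
- exact: (lie_bilinear (s := L1)).2.
- exact: (lie_bilinear (s := L2)).2.
Qed.

Fact pair_liexx x : pair_lie x x = 0.
Proof. by rewrite /pair_lie !liexx. Qed.

Fact pair_jacobi x y z :
  pair_lie x (pair_lie y z) + pair_lie y (pair_lie z x)
    + pair_lie z (pair_lie x y) = 0.
Proof. by congr pair; exact: lie_jacobi. Qed.

HB.instance Definition _ := hasLieBracket.Build F (L1 * L2)%type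
  pair_lie_bilinear pair_liexx pair_jacobi.

End LieSum.


Section MatrixLie.
Variables (F : fieldType) (n : nat).

Definition mx_lie (A B : 'M[F]_n) : 'M[F]_n := A *m B - B *m A.

Fact mx_lie_bilinear : bilinear_for *:%R *:%R mx_lie.
Proof.
split=> C a A B; rewrite /mx_lie /=.
  by rewrite mulmxDl mulmxDr -scalemxAl -scalemxAr opprD addrACA scalerBr.
by rewrite mulmxDl mulmxDr -scalemxAl -scalemxAr opprD addrACA scalerBr.
Qed.

Fact mx_liexx A : mx_lie A A = 0.
Proof. exact: subrr. Qed.

Fact mx_jacobi A B C :
  mx_lie A (mx_lie B C) + mx_lie B (mx_lie C A) + mx_lie C (mx_lie A B) = 0.
Proof. by rewrite /mx_lie !mulmxBr !mulmxBl !mulmxA; exact: commutator_jacobi. Qed.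

HB.instance Definition _ := hasLieBracket.Build F 'M[F]_n
  mx_lie_bilinear mx_liexx mx_jacobi.

End MatrixLie.

Section EndLie.
Variables (F : fieldType) (W : vectType F).

Definition end_lie (x y : 'End(W)) : 'End(W) := (x \o y)%VF - (y \o x)%VF.

Fact end_lie_bilinear : bilinear_for *:%R *:%R end_lie.
Proof.
split=> z a x y; rewrite /end_lie /=;
  by rewrite comp_lfunDl comp_lfunDr -comp_lfunZl -comp_lfunZr
             opprD addrACA scalerBr.
Qed.

Fact end_liexx x : end_lie x x = 0.
Proof. exact: subrr. Qed.

Fact end_jacobi x y z :
  end_lie x (end_lie y z) + end_lie y (end_lie z x) + end_lie z (end_lie x y)
  = 0.
Proof.
rewrite /end_lie !(comp_lfunDl, comp_lfunDr, comp_lfunNl, comp_lfunNr).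
by rewrite !comp_lfunA; exact: commutator_jacobi.
Qed.

HB.instance Definition _ := hasLieBracket.Build F 'End(W)
  end_lie_bilinear end_liexx end_jacobi.

End EndLie.

(* L(g), first as the subspace of End(W) cut out by the defining equations on
   a basis (see form_lie_spaceP), then as a Lie algebra in its own right. *)

Section FormLie.
Variables (F : fieldType) (W : vectType F) (g : {biscalar W}).

Definition skew_defect (x : 'End(W)) : 'M[F]_(\dim {:W}) :=
  \matrix_(i, j) (g (x (vbasis {:W})`_i) (vbasis {:W})`_j
                  + g (vbasis {:W})`_i (x (vbasis {:W})`_j)).

Fact skew_defect_is_linear : linear skew_defect.
Proof.
move=> a x y; apply/matrixP=> i j; rewrite !mxE !lfunE /= !lfunE /=.
by rewrite linearDl linearDr linearZl_LR linearZr_LR /= addrACA mulrDr.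
Qed.

HB.instance Definition _ := GRing.isLinear.Build F 'End(W)
  'M[F]_(\dim {:W}) _ skew_defect skew_defect_is_linear.

Definition form_lie_space : {vspace 'End(W)} := lker (linfun skew_defect).

Lemma form_lie_spaceP (x : 'End(W)) :
  reflect (forall v w, g (x v) w = - g v (x w)) (x \in form_lie_space).
Proof.
rewrite memv_ker lfunE /=; apply: (iffP eqP) => [x0 v w | xP]; last first.
  by apply/matrixP=> i j; rewrite !mxE xP addNr.
apply/eqP; rewrite -addr_eq0.
rewrite (coord_vbasis (memvf v)) (coord_vbasis (memvf w)).
rewrite !(linear_sum x) !linear_sumlz -big_split big1 //= => i _.
rewrite !linear_sumr -big_split big1 //= => j _.
rewrite !(linearZ_LR x) /= !linearZl_LR !linearZr_LR /=.
have /matrixP/(_ i j) := x0; rewrite !mxE => e0.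
by rewrite -!mulrDr e0 !mulr0.
Qed.

Fact form_lie_closed x y :
  x \in form_lie_space -> y \in form_lie_space -> lie x y \in form_lie_space.
Proof.
move=> /form_lie_spaceP xP /form_lie_spaceP yP; apply/form_lie_spaceP => v w.
rewrite !lfunE /= !lfunE /= !lfunE /=.
rewrite linearDl linearDr linearNl linearNr /= !xP !yP !(xP, yP) !opprK.
by rewrite opprB addrC.
Qed.

Definition form_lie : Type := subvs_of form_lie_space.
HB.instance Definition _ := Vector.on form_lie.

Definition sub_lie (x y : form_lie) : form_lie :=
  Subvs (form_lie_closed (subvsP x) (subvsP y)).

Fact sub_lie_bilinear : bilinear_for *:%R *:%R sub_lie.
Proof.
split=> z a x y; apply: val_inj.
  exact: (lie_bilinear (s := 'End(W))).1.
exact: (lie_bilinear (s := 'End(W))).2.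
Qed.

Fact sub_liexx x : sub_lie x x = 0.
Proof. by apply: val_inj; exact: liexx. Qed.

Fact sub_jacobi x y z :
  sub_lie x (sub_lie y z) + sub_lie y (sub_lie z x) + sub_lie z (sub_lie x y)
  = 0.
Proof. by apply: val_inj; exact: lie_jacobi. Qed.

HB.instance Definition _ := hasLieBracket.Build F form_lie
  sub_lie_bilinear sub_liexx sub_jacobi.

End FormLie.

Section Restriction.
Variables (F : fieldType) (V : vectType F) (f : {biscalar V}).
Variable U : {vspace V}.

Definition restrict_form (u v : subvs_of U) : F := f (vsval u) (vsval v).

Fact restrict_form_bilinear : bilinear_for *%R *%R restrict_form.
Proof.
split=> w a u v; rewrite /restrict_form.
  by rewrite (linearP (@vsval _ _ U)) linearPl.
by rewrite (linearP (@vsval _ _ U)) linearPr.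
Qed.

HB.instance Definition _ := bilinear_isBilinear.Build F
  (subvs_of U) (subvs_of U) F *%R *%R restrict_form restrict_form_bilinear.

End Restriction.

Arguments restrict_form {F V} f U u v.

Section Decomposition.
Variables (F : fieldType) (V : vectType F) (f : {biscalar V}).

(* W = U_1 _|_ ... _|_ U_m for subspaces U_i of V *)
Definition orthogonal_sum (W : {vspace V}) m (U : 'I_m -> {vspace V}) : Prop :=
  [/\ (\sum_(i < m) U i)%VS = W,
      directv (\sum_(i < m) U i)
    & forall i j, i != j -> forall u v, u \in U i -> v \in U j -> f u v = 0].

(* the restriction of f to W is indecomposable *)
Definition indecomposable (W : {vspace V}) : Prop :=
  W != 0%VS /\
  ~ exists U : 'I_2 -> {vspace V},
      orthogonal_sum W U /\ forall i, U i != 0%VS.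

Definition nilp_jordan n : 'M[F]_n :=
  \matrix_(i < n, j < n) (i == j.+1 :> nat)%:R.

Definition has_jordan_gram n (W : {vspace V}) : Prop :=
  exists e : n.-tuple V,
    basis_of W e /\ \matrix_(i < n, j < n) f e`_i e`_j = nilp_jordan n.

Section Parts.
Variables (m : nat) (U : 'I_m -> {vspace V}).

Definition Veven : {vspace V} :=
  (\sum_(i < m | `[< exists n, ~~ odd n /\ has_jordan_gram n (U i) >]) U i)%VS.

Definition Vodd : {vspace V} :=
  (\sum_(i < m | `[< exists n, odd n /\ has_jordan_gram n (U i) >]) U i)%VS.

Definition Vndeg : {vspace V} :=
  (\sum_(i < m | `[< ~ exists n, has_jordan_gram n (U i) >]) U i)%VS.

End Parts.

Lemma exists_indecomposable_sum (W : {vspace V}) :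
  exists m (U : 'I_m -> {vspace V}),
    orthogonal_sum W U /\ forall i, indecomposable (U i).
Proof.
have [k] := ubnP (\dim W); elim: k W => // k IH W; rewrite ltnS => leWk.
have [->|W0] := eqVneq W 0%VS.
  exists 0, (fun=> 0%VS); split; last by case.
  by split; [rewrite big_ord0 | rewrite directvE /= !big_ord0 dimv0 | case].
have [Windec|Wdec] := pselect (indecomposable W).
  exists 1, (fun=> W); split=> //; split; first by rewrite big_ord1.
    by rewrite directvE /= !big_ord1.
  by move=> i j; rewrite !ord1.
have [U [[sumU dxU orthU] Un0]] : exists U : 'I_2 -> {vspace V},
    orthogonal_sum W U /\ forall i, U i != 0%VS.
  by apply: contrapT => noU; apply: Wdec.
have dimU : (\dim (U ord0) + \dim (U ord_max) = \dim W)%N.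
  move: dxU; rewrite directvE /= sumU => /eqP->.
  by rewrite !big_ord_recl big_ord0 addn0; congr (_ + \dim (U _))%N; apply: val_inj.
have dimUgt0 i : (0 < \dim (U i))%N by rewrite lt0n dimv_eq0.
have ltU i : (\dim (U i) < k)%N.
  apply: leq_trans leWk; rewrite -dimU.
  have [->|->] : i = ord0 \/ i = ord_max.
    by case: i => [[|[|//]] ?]; [left|right]; apply: val_inj.
  by rewrite -addn1 leq_add2l.
  by rewrite -add1n leq_add2r.
have [m0 [A [[sumA dxA orthA] indA]]] := IH _ (ltU ord0).
have [m1 [B [[sumB dxB orthB] indB]]] := IH _ (ltU ord_max).
pose C i := match split i with inl i => A i | inr j => B j end.
have Cl i : C (lshift m1 i) = A i.
  by rewrite /C -[lshift _ _]/(unsplit (inl i)) unsplitK.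
have Cr i : C (rshift m0 i) = B i.
  by rewrite /C -[rshift _ _]/(unsplit (inr i)) unsplitK.
have sumC : (\sum_i C i)%VS = W.
  rewrite big_split_ord /= (eq_bigr _ (fun i _ => Cl i)).
  rewrite (eq_bigr _ (fun i _ => Cr i)) sumA sumB -sumU.
  by rewrite !big_ord_recl big_ord0 addv0; congr (_ + U _)%VS; apply: val_inj.
have AU i : (A i <= U ord0)%VS by rewrite -sumA (sumv_sup i).
have BU i : (B i <= U ord_max)%VS by rewrite -sumB (sumv_sup i).
exists (m0 + m1)%N, C; split; last first.
  by move=> i; rewrite /C; case: (split i).
split=> //.
  rewrite directvE /= sumC big_split_ord /=.
  rewrite (eq_bigr _ (fun i _ => congr1 (@dimv _ _) (Cl i))).
  rewrite (eq_bigr _ (fun i _ => congr1 (@dimv _ _) (Cr i))).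
  move: dxA dxB; rewrite !directvE /= sumA sumB => /eqP<- /eqP<-.
  by rewrite dimU.
move=> i j; rewrite -(splitK i) -(splitK j).
case: (split i) (split j) => {}i [] {}j /=; rewrite ?Cl ?Cr => neq u v uP vP.
- by apply: orthA uP vP; apply: contraNneq neq => ->.
- by apply: (orthU ord0 ord_max) (subvP (AU _) _ uP) (subvP (BU _) _ vP).
- by apply: (orthU ord_max ord0) (subvP (BU _) _ uP) (subvP (AU _) _ vP).
- by apply: orthB uP vP; apply: contraNneq neq => ->.
Qed.

End Decomposition.

(* Main.v *)
From HB Require Import structures.
From mathcomp Require Import all_boot all_order all_algebra.
From mathcomp Require Import boolp.
From mathcomp Require Import zify ring.
Require Import Defs.

Set Implicit Arguments.
Unset Strict Implicit.
Unset Printing Implicit Defensive.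

Import GRing.Theory.
Local Open Scope ring_scope.

(** The argument rests on the shape of the blocks. Number the basis of a
    Jordan block J_n as e_0, ..., e_(n-1), so that f(e_(i+1), e_i) = 1 and every
    other value is 0. Then, as linear forms,
      f(e_0, .) = 0,   f(e_(i+2), .) = f(., e_i),   f(., e_(n-1)) = 0,
    and these relations hold on the whole of V once the block is an orthogonal
    summand; they are what [jordan_chain] records. Conversely such relations make
    a chain with Gram matrix J_n split off. A degenerate form always admits a
    chain, by induction on the dimension: pass to the quotient of the orthogonal
    of the right radical by that radical, and lengthen a chain found there by
    two. So an indecomposable form is either some J_n or non-degenerate
    ([indecomposable_nondegenerate]).

    Call v descending if there are v = v_0, v_1, ..., v_k = 0 with
    f(v_j, .) = f(., v_(j+1)). Elements x of L(f) satisfy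
    f(x v, .) = - f(v, x .), so they map descending vectors to descending
    vectors. In J_n the vectors e_0, e_2, e_4, ... are descending.

    If no block is odd, the vectors e_(n-1), e_(n-3), ... of an even block
    exhaust its remaining basis vectors and are descending for the transposed
    form. A descending vector, for f or for its transpose, has no component in a
    non-degenerate orthogonal summand. Hence L(f) preserves V_even, and then
    also V_ndeg because no nonzero vector of V_even is orthogonal to V_even on
    both sides. Restriction to the two summands is therefore an isomorphism
    ([even_ndeg_isomorphic]), and reductivity passes to and from a direct sum.

    If there is an odd block and f is not 0, the space M of all descending
    vectors is totally isotropic, and the x in L(f) with x V inside M and
    x M = 0 form an abelian ideal. It is not central. For n >= 3 it contains
      x(u) = sum over j of f(c_(j+1), u) (c_(j+1) - c_j),   c_j = e_(2j),
    which does not commute with the h in L(f) that multiplies e_i by (-1)^i and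
    kills the orthogonal complement of the block: as h x - x h = 2 x on the
    block, this uses that the characteristic is not 2
    ([odd_chain_not_reductive]). For n = 1 the block is spanned by a vector r of
    both radicals, and a nonzero x = phi(.) r with phi vanishing on M does not
    commute with a projection onto the line of r ([radical_not_reductive]).

    Finally L(0) = gl(V) is reductive: a non-central ideal contains a matrix
    unit E_ij with i and j distinct, and from [[E_ij, E_ji], E_ij] = 2 E_ij this
    matrix stays in every term of the derived series ([reductive_mx]). *)

(** * Linear algebra preliminaries *)

(** Among the subspaces on which P holds, one of maximal dimension contains every
    vector satisfying P. This turns a linear condition stated with quantifiers
    into a subspace whose dimension can be used. *)
Lemma vspace_of_closed (F : fieldType) (V : vectType F) (P : V -> Prop) :
    P 0 -> (forall a u v, P u -> P v -> P (a *: u + v)) ->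
  exists W : {vspace V}, forall v, v \in W <-> P v.
Proof.
move=> P0 Plin.
suff: forall k (W : {vspace V}), (\dim {:V} - \dim W < k)%N ->
    (forall v, v \in W -> P v) ->
    exists W' : {vspace V}, forall v, v \in W' <-> P v.
  by move=> /(_ _ 0%VS (leqnn _)); apply=> v; rewrite memv0 => /eqP->.
elim=> // k IH W ltWk WP.
have [PW|] := pselect (forall v, P v -> v \in W); first by exists W => v; split=> [/WP|/PW].
move=> /existsNP[v /not_implyP[Pv /negP vW]].
apply: (IH (<[v]> + W)%VS) => [|u].
  have ltWv : (\dim W < \dim (<[v]> + W))%N.
    rewrite ltn_neqAle dimvS ?addvSr // andbT; apply: contra vW => /eqP eqd.
    suff -> : W = (<[v]> + W)%VS by apply/(subvP (addvSl _ _))/memv_line.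
    by apply/eqP; rewrite eqEdim addvSr eqd leqnn.
  have ltWV := leq_trans ltWv (dimvS (subvf _)).
  by move: ltWk; rewrite !ltnS; apply: leq_trans; apply: ltn_sub2l.
by move=> /memv_addP[_ /vlineP[a ->] [w /WP Pw ->]]; apply: Plin.
Qed.

Lemma lfun_of_linear (F : fieldType) (V W : vectType F) (g : V -> W) :
  linear g -> exists x : 'Hom(V, W), forall u, x u = g u.
Proof.
move=> g_lin.
pose gL : {linear V -> W} := HB.pack g (GRing.isLinear.Build F V W *:%R g g_lin).
by exists (linfun gL) => u; rewrite lfunE.
Qed.

Lemma injective_surjective_bij (A B : Type) (g : A -> B) :
  injective g -> (forall b, exists a, g a = b) -> bijective g.
Proof.
move=> g_inj /choice[h gh]; exists h => // a.
by apply: g_inj; rewrite gh.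
Qed.

(** * Gram matrices and annihilators *)

(** Transposing f exchanges left and right, which halves the number of proofs
    about radicals and chains. *)
Section Flip.
Variables (F : fieldType) (V : vectType F) (f : {biscalar V}).

Definition flip_form (u v : V) : F := f v u.

Fact flip_form_bilinear : bilinear_for *%R *%R flip_form.
Proof.
by split=> w a u v; rewrite /flip_form; [rewrite linearPr | rewrite linearPl].
Qed.

HB.instance Definition _ := bilinear_isBilinear.Build F V V F *%R *%R
  flip_form flip_form_bilinear.

End Flip.

Section Radicals.
Variables (F : fieldType) (V : vectType F) (f : {biscalar V}).
Implicit Types (S W : {vspace V}) (u v w : V).

Definition left_nondegenerate W :=
  forall v, v \in W -> (forall w, w \in W -> f v w = 0) -> v = 0.
Definition right_nondegenerate W :=
  forall v, v \in W -> (forall w, w \in W -> f w v = 0) -> v = 0.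

Definition gram S W : 'M[F]_(\dim S, \dim W) :=
  \matrix_(i, j) f (vbasis S)`_i (vbasis W)`_j.

Lemma gram_col S W (c : 'cV[F]_(\dim W)) i :
  (gram S W *m c) i ord0
  = f (vbasis S)`_i (\sum_j c j ord0 *: (vbasis W)`_j).
Proof.
rewrite mxE linear_sumr; apply: eq_bigr => j _.
by rewrite mxE linearZr_LR mulrC.
Qed.

Lemma gram_row S W (r : 'rV[F]_(\dim S)) j :
  (r *m gram S W) ord0 j
  = f (\sum_i r ord0 i *: (vbasis S)`_i) (vbasis W)`_j.
Proof.
rewrite mxE linear_sumlz; apply: eq_bigr => i _.
by rewrite mxE linearZl_LR.
Qed.

Lemma sum_vbasis W (k : 'I_(\dim W) -> F) :
  \sum_i k i *: (vbasis W)`_i \in W.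
Proof.
by apply: memv_suml => i _; rewrite memvZ // vbasis_mem // mem_nth // size_tuple.
Qed.

Lemma vbasis_nth_mem W (i : 'I_(\dim W)) : (vbasis W)`_i \in W.
Proof. by rewrite vbasis_mem // mem_nth // size_tuple. Qed.

Lemma eq0_on_vbasisr S u :
  (forall i : 'I_(\dim S), f u (vbasis S)`_i = 0) -> forall w, w \in S -> f u w = 0.
Proof.
move=> f0 w wW; rewrite (coord_vbasis wW) linear_sumr big1 // => i _.
by rewrite linearZr_LR f0 /= mulr0.
Qed.

Lemma eq0_on_vbasisl S u :
  (forall i : 'I_(\dim S), f (vbasis S)`_i u = 0) -> forall w, w \in S -> f w u = 0.
Proof.
move=> f0 w wW; rewrite (coord_vbasis wW) linear_sumlz big1 // => i _.
by rewrite linearZl_LR f0 /= mulr0.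
Qed.

(** The row of values of phi on a basis of W is killed by every column that the
    Gram matrix kills, so it lies in the row space of that matrix; the
    coefficients give s. *)
Lemma double_annihilator S W (phi : V -> F) : scalar phi ->
    (forall w, w \in W -> (forall s, s \in S -> f s w = 0) -> phi w = 0) ->
  exists2 s, s \in S & forall w, w \in W -> f s w = phi w.
Proof.
move=> phi_lin phi0.
pose Lphi := GRing.isLinear.Build F V F *%R phi phi_lin.
pose phiL : {scalar V} := HB.pack phi Lphi.
pose p : 'rV[F]_(\dim W) := \row_j phi (vbasis W)`_j.
have : (p <= gram S W)%MS.
  rewrite submxE; apply/eqP/matrixP => i j; rewrite ord1 mxE [RHS]mxE.
  pose c := col j (cokermx (gram S W)).
  transitivity (phi (\sum_k c k ord0 *: (vbasis W)`_k)).
    rewrite -[phi]/(phiL : _ -> _) linear_sum; apply: eq_bigr => k _.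
    by rewrite linearZ_LR !mxE mulrC.
  apply: phi0; first exact: sum_vbasis.
  apply: eq0_on_vbasisl => k; rewrite -gram_col.
  by rewrite /c colE mulmxA mulmx_coker mul0mx mxE.
move=> /submxP[r def_p].
exists (\sum_i r ord0 i *: (vbasis S)`_i); first exact: sum_vbasis.
move=> w wW; rewrite (coord_vbasis wW) linear_sumr.
rewrite -[phi]/(phiL : _ -> _) linear_sum; apply: eq_bigr => j _.
rewrite linearZr_LR linearZ_LR -gram_row -def_p !mxE //.
Qed.

Lemma free_vbasis_eq0 W (k : 'I_(\dim W) -> F) :
  \sum_i k i *: (vbasis W)`_i = 0 -> forall i, k i = 0.
Proof. by apply: (freeP (basis_free (vbasisP W))). Qed.

Lemma left_nondegenerateE W :
  left_nondegenerate W <-> gram W W \in unitmx.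
Proof.
rewrite -row_free_unit; split=> [ndW | freeG v vW v0].
  rewrite -kermx_eq0; apply/eqP/row_matrixP => i; rewrite row0.
  set r := row i _; have r0 : r *m gram W W = 0.
    by rewrite /r -row_mul mulmx_ker row0.
  apply/rowP => j; rewrite [RHS]mxE; move: j; apply: free_vbasis_eq0.
  apply: ndW; first exact: sum_vbasis.
  by apply: eq0_on_vbasisr => j; rewrite -gram_row r0 mxE.
pose r : 'rV[F]_(\dim W) := \row_i coord (vbasis W) i v.
have : r *m gram W W = 0.
  apply/rowP => j; rewrite gram_row mxE.
  under eq_bigr do rewrite mxE.
  by rewrite -(coord_vbasis vW) v0 ?vbasis_nth_mem.
move=> /eqP; rewrite mulmx_free_eq0 // => /eqP/rowP r0.
rewrite (coord_vbasis vW) big1 // => i _.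
by move: (r0 i); rewrite !mxE => ->; rewrite scale0r.
Qed.

End Radicals.

(** A square matrix is invertible exactly when its transpose is. *)
Lemma nondegenerate_sym (F : fieldType) (V : vectType F) (f : {biscalar V})
    (W : {vspace V}) :
  left_nondegenerate f W <-> right_nondegenerate f W.
Proof.
rewrite left_nondegenerateE -unitmx_tr.
have -> : (gram f W W)^T = gram (flip_form f) W W.
  by apply/matrixP => i j; rewrite !mxE.
by rewrite -left_nondegenerateE.
Qed.

(** * Degenerate forms split off a Jordan block *)

Section JordanChain.
Variables (F : fieldType) (V : vectType F) (f : {biscalar V}).
Implicit Types (W : {vspace V}) (u v w : V).

(** Besides the Gram matrix J_n, the relations below say that the linear forms
    f(e_i, .) and f(., e_i) on W satisfy all the identities they satisfy on the
    span of the chain; this is exactly what makes that span an orthogonal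
    summand of W. Without [chain_neq0] the zero vector would
    form a chain of length 1. *)
Record jordan_chain W (n : nat) (e : nat -> V) : Prop := JordanChain {
  chain_mem : forall i, (i < n)%N -> e i \in W;
  chain_neq0 : e 0 != 0;
  chain_gram : forall i j, (i < n)%N -> (j < n)%N ->
    f (e i) (e j) = (i == j.+1)%:R;
  chain_bottom : forall w, w \in W -> f (e 0) w = 0;
  chain_top : forall w, w \in W -> f w (e n.-1) = 0;
  chain_step : forall i w, (i.+2 < n)%N -> w \in W -> f (e i.+2) w = f w (e i)
}.

(** Here N is the right radical of W, N1 is the right orthogonal of N in W, and W'
    is a complement of N in N1, carrying the form induced on N1 / N. *)
Section Extension.
Variables (W N N1 W' : {vspace V}).
Hypothesis memN : forall v,
  v \in N <-> v \in W /\ forall w, w \in W -> f w v = 0.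
Hypothesis memN1 : forall v,
  v \in N1 <-> v \in W /\ forall u, u \in N -> f u v = 0.
Hypothesis W'N1 : (W' <= N1)%VS.
Hypothesis W'N : (N1 <= W' + N)%VS.
Hypothesis W'capN : (W' :&: N = 0)%VS.

Let N_W v : v \in N -> v \in W. Proof. by move=> /memN[]. Qed.
Let N1_W v : v \in N1 -> v \in W. Proof. by move=> /memN1[]. Qed.
Let W'_N1 v : v \in W' -> v \in N1. Proof. exact: subvP W'N1 v. Qed.
Let W'_W v : v \in W' -> v \in W. Proof. by move=> /W'_N1/N1_W. Qed.
Let fWN w v : w \in W -> v \in N -> f w v = 0.
Proof. by move=> wW /memN[_]; apply. Qed.
Let fNN1 u v : u \in N -> v \in N1 -> f u v = 0.
Proof. by move=> uN /memN1[_]; apply. Qed.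

Lemma scalar_difference a b : scalar (fun w => f w a - f b w).
Proof.
by move=> c u v; rewrite linearPl linearPr /= mulrBr opprD addrACA.
Qed.

(** A linear form that vanishes on N1, the annihilator of N in W, is given by N. *)
Lemma represent_on_N a b : a \in W -> b \in W ->
    (forall w, w \in N1 -> f w a = f b w) ->
  exists2 x, x \in N & forall w, w \in W -> f x w = f w a - f b w.
Proof.
move=> aW bW eq_ab; apply: double_annihilator; first exact: scalar_difference.
by move=> w wW wN; rewrite eq_ab ?subrr //; apply/memN1; split.
Qed.

(** As a is orthogonal to N, the difference vanishes on the right radical N, which
    is the annihilator of W in W. *)
Lemma represent_on_W a b : b \in W -> a \in N1 ->
  exists2 x, x \in W & forall w, w \in W -> f x w = f w a - f b w.
Proof.
move=> bW aN1; apply: double_annihilator; first exact: scalar_difference.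
by move=> w wW wr; rewrite wr // subr0 fNN1 //; apply/memN; split.
Qed.

(** A relation f(x, .) = f(., a) valid on N1 becomes valid on W after moving x
    within its class modulo N, which affects no value of f(., x) on W. *)
Lemma adjust_mod_N x a : x \in W -> a \in W ->
    (forall w, w \in N1 -> f w a = f x w) ->
  exists y, y - x \in N /\ forall w, w \in W -> f y w = f w a.
Proof.
move=> xW aW /represent_on_N[] // z zN fz.
exists (x + z); split; first by rewrite addrC addKr.
by move=> w wW; rewrite linearDl /= fz // addrC subrK.
Qed.

(** Relations between linear forms only need to be checked on W', since N is
    orthogonal to N1 on both sides. *)
Lemma extend_to_N1 a b : a \in N1 -> b \in W ->
  (forall w, w \in W' -> f w a = f b w) -> forall w, w \in N1 -> f w a = f b w.
Proof.
move=> aN1 bW eq_ab w /(subvP W'N)/memv_addP[w' w'W' [z zN ->]].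
rewrite linearDl linearDr /= eq_ab //; congr (_ + _).
by rewrite fNN1 // fWN.
Qed.

(** The only vector e_0 of the chain lies in both radicals of W'. It is moved
    modulo N into the left radical of W, and becomes the bottom y of the new
    chain; the top z in N is forced by f(z, .) = f(., e_0). The middle vector is
    constrained only by the Gram matrix. *)
Lemma extend_singleton_chain e :
  jordan_chain W' 1 e -> exists e', jordan_chain W 3 e'.
Proof.
case=> /(_ 0 isT) e0W' e0_neq0 _ bot top _; have e0N1 := W'_N1 e0W'.
have e0W := N1_W e0N1.
have [y [yN fy]] : exists y, y - e 0 \in N /\ forall w, w \in W -> f y w = f w 0.
  apply: adjust_mod_N; rewrite ?mem0v //; apply: extend_to_N1; rewrite ?mem0v //.
  by move=> w wW'; rewrite linear0r bot.
have [z zN fz] : exists2 z, z \in N & forall w, w \in W -> f z w = f w (e 0).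
  have [||w wN1|z zN fz] := @represent_on_N (e 0) 0; rewrite ?mem0v //.
    apply: extend_to_N1; rewrite ?mem0v // => w' w'W'.
    by rewrite linear0l top.
  by exists z => // w wW; rewrite fz // linear0l subr0.
have [v vW fv] : exists2 v, v \in W & f v (e 0) = 1.
  have : e 0 \notin N.
    apply: contra e0_neq0 => e0N; rewrite -memv0 -W'capN.
    by apply/memv_capP.
  have [w0|/existsNP[w /not_implyP[wW /eqP fw]] _] :=
      pselect (forall w, w \in W -> f w (e 0) = 0).
    by case/negP; apply/memN.
  exists ((f w (e 0))^-1 *: w); first exact: memvZ.
  by rewrite linearZl_LR /= mulVf.
have fwy w : w \in W -> f w y = f w (e 0).
  by move=> wW; rewrite -(subrK (e 0) y) linearDr /= fWN // add0r.
have yW : y \in W by rewrite -(subrK (e 0) y) memvD // N_W.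
(* Since f(z, v) = 1 and f(., z) = 0, this makes v' isotropic. *)
pose v' := v - f v v *: z.
have v'W : v' \in W by rewrite memvB ?memvZ // N_W.
have fz0 w : w \in W -> f w z = 0 by move=> wW; apply: fWN.
have zW := N_W zN.
exists (fun i => if i is k.+1 then if k is 0 then v' else z else y); split.
- by move=> [|[|]].
- apply: contra_eq_neq fv => y0; rewrite -fwy // y0 linear0r.
  by rewrite eq_sym oner_neq0.
- move=> [|[|[|//]]] [|[|[|//]]] _ _ //=.
  + by rewrite fy // linear0r.
  + by rewrite fy // linear0r.
  + by rewrite fz0.
  + by rewrite fwy // /v' linearBl linearZl_LR /= (fNN1 zN e0N1) fv mulr0 subr0.
  + rewrite linearBl linearZl_LR /= !linearBr !linearZr_LR /= !fz0 // !mulr0 !subr0.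
    by rewrite fz // fv mulr1 subrr.
  + by rewrite fz0.
  + by rewrite fwy // (fNN1 zN e0N1).
  + by rewrite fz // /v' linearBl linearZl_LR /= (fNN1 zN e0N1) fv mulr0 subr0.
  + by rewrite fz0.
- by move=> w wW; rewrite fy // linear0r.
- by move=> w wW /=; apply: fz0.
- by move=> [|//] w _ wW; rewrite fz // fwy.
Qed.

(** The new vectors v and z, placed above the chain, are dictated by
    f(v, .) = f(., e_n) and f(z, .) = f(., e_(n+1)). The old ones are moved
    modulo N so that their relations hold on W; the Gram matrix then follows
    from the relations except for f(e_1, v), and e_1, whose left linear form
    is not prescribed, has the freedom to make it 0. *)
Lemma extend_long_chain n e :
  jordan_chain W' n.+2 e -> exists e', jordan_chain W n.+4 e'.
Proof.
case=> eW' e0_neq0 gram bot top step.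
have eN1 i : (i < n.+2)%N -> e i \in N1 by move=> /eW'/W'_N1.
have eW i : (i < n.+2)%N -> e i \in W by move=> /eN1/N1_W.
have [z zN fz] : exists2 z, z \in N & forall w, w \in W -> f z w = f w (e n.+1).
  have [|||z zN fz] := @represent_on_N (e n.+1) 0; rewrite ?mem0v ?eW //.
    apply: extend_to_N1; rewrite ?mem0v ?eN1 // => w' w'W'.
    by rewrite linear0l top.
  by exists z => // w wW; rewrite fz // linear0l subr0.
have [v vW fv] : exists2 v, v \in W & forall w, w \in W -> f v w = f w (e n).
  have [||v vW fv] := @represent_on_W (e n) 0; rewrite ?mem0v ?eN1 //.
  by exists v => // w wW; rewrite fv // linear0l subr0.
have zW := N_W zN.
have fzv : f z v = 1 by rewrite fz // fv ?eW // gram ?eqxx.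
have /choice[x xP] : forall i, exists y, (i < n.+2)%N -> y - e i \in N /\
    match i with
    | 0 => forall w, w \in W -> f y w = 0
    | 1 => f y v = 0
    | k.+2 => forall w, w \in W -> f y w = f w (e k)
    end.
  move=> i; have [lti|_] := boolP (i < n.+2)%N; last by exists 0.
  case: i lti => [|[|k]] lti.
  - have [||w wN1|y [yN fy]] := @adjust_mod_N (e 0) 0; rewrite ?mem0v ?eW //.
      apply: extend_to_N1; rewrite ?mem0v ?eW // => w' w'W'.
      by rewrite linear0r bot.
    by exists y => _; split=> // w wW; rewrite fy // linear0r.
  - exists (e 1 - f (e 1) v *: z) => _; split.
      by rewrite addrAC subrr sub0r memvN memvZ.
    by rewrite linearBl linearZl_LR /= fzv mulr1 subrr.
  - have [||w wN1|y [yN fy]] := @adjust_mod_N (e k.+2) (e k);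
      rewrite ?eW ?(ltnW (ltnW lti)) //.
      apply: extend_to_N1; rewrite ?eW ?eN1 ?(ltnW (ltnW lti)) // => w' w'W'.
      by rewrite step.
    by exists y.
have xN i : (i < n.+2)%N -> x i - e i \in N by move=> /xP[].
have xW i : (i < n.+2)%N -> x i \in W.
  by move=> lti; rewrite -(subrK (e i) (x i)) memvD ?eW // N_W ?xN.
have fx w i : (i < n.+2)%N -> w \in W -> f w (x i) = f w (e i).
  by move=> lti wW; rewrite -(subrK (e i) (x i)) linearDr /= fWN ?xN ?add0r.
have fxN1 w i : (i < n.+2)%N -> w \in N1 -> f (x i) w = f (e i) w.
  move=> lti wN1; rewrite -(subrK (e i) (x i)) linearDl /=.
  by rewrite fNN1 ?xN ?add0r.
have x0 w : w \in W -> f (x 0) w = 0 by case: (xP 0 isT) => _; apply.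
have x1 : f (x 1) v = 0 by case: (xP 1 isT).
have x2 i w : (i.+2 < n.+2)%N -> w \in W -> f (x i.+2) w = f w (e i).
  by move=> /xP[_]; apply.
pose e' i := if (i < n.+2)%N then x i else if i == n.+2 then v else z.
have e'x i : (i < n.+2)%N -> e' i = x i by rewrite /e' => ->.
have e'v : e' n.+2 = v by rewrite /e' ltnn eqxx.
have e'z : e' n.+3 = z by rewrite /e' ltnNge leqW //= gtn_eqF.
have ltnP4 i : (i < n.+4)%N -> [\/ (i < n.+2)%N, i = n.+2 | i = n.+3].
  rewrite !ltnS leq_eqVlt => /orP[/eqP->|]; first exact: Or33.
  by rewrite ltnS leq_eqVlt => /orP[/eqP->|]; [apply: Or32 | apply: Or31].
have e'W i : (i < n.+4)%N -> e' i \in W.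
  by move=> /ltnP4[lti|->|->]; rewrite ?e'v ?e'z ?e'x ?xW.
have fz0 w : w \in W -> f w z = 0 by move=> wW; apply: fWN.
exists e'; split=> //.
- rewrite e'x //; apply/eqP => x00; have := gram 1 0 isT isT.
  by rewrite -fx ?eW // x00 linear0r => /eqP; rewrite eq_sym oner_eq0.
- move=> i j /[dup] /e'W e'iW /ltnP4 ci /ltnP4 [ltj|->|->]; last first.
  + rewrite e'z fz0 // ltn_eqF //; case: ci => [lti|->|->]; lia.
  + rewrite e'v; case: ci e'iW => [lti|->|->] _; rewrite ?e'v ?e'z ?e'x //.
    * case: i lti => [|[|i]] lti; rewrite ?x0 ?x1 ?x2 //.
      rewrite fv ?eW ?gram ?ltn_eqF ?(ltnW (ltnW lti)) //; lia.
    * by rewrite fv // fv ?eW // gram // !ltn_eqF.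
    * by rewrite fzv eqxx.
  + rewrite (e'x j) // fx //; case: ci e'iW => [lti|->|->] _; rewrite ?e'v ?e'z ?e'x //.
    * by rewrite fxN1 ?eN1 // gram.
    * by rewrite fv ?eW // gram // eqSS eq_sym.
    * by rewrite fz ?eW // gram // eqSS eq_sym.
- by move=> w wW; rewrite /= e'z fz0.
- move=> i w; rewrite !ltnS => lei wW; have lti : (i < n.+2)%N by rewrite ltnS.
  rewrite (e'x i) // fx //; case: (ltnP4 i.+2) => [|lti2|[->]|[->]] //.
  + by rewrite e'x // x2.
  + by rewrite e'v fv.
  + by rewrite e'z fz.
Qed.

End Extension.
End JordanChain.

Section Classification.
Variables (F : fieldType) (V : vectType F) (f : {biscalar V}).
Implicit Types (W : {vspace V}) (u v w : V).

(** A nonzero r in the left radical gives a chain of length 1 if it also lies in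
    the right radical N, and one of length 2 if it is not orthogonal to N.
    Otherwise its component in W' is a nonzero vector of the left radical of W',
    and a chain of W', given by induction, is lengthened by two. *)
Lemma exists_jordan_chain W : ~ left_nondegenerate f W ->
  exists n e, (0 < n)%N /\ jordan_chain f W n e.
Proof.
have [k] := ubnP (\dim W); elim: k W => // k IH W; rewrite ltnS => leWk ldegW.
have [N memN] : exists N : {vspace V}, forall v,
    v \in N <-> v \in W /\ forall w, w \in W -> f w v = 0.
  apply: vspace_of_closed => [|a u v [uW u0] [vW v0]].
    by split=> [|w _]; rewrite ?mem0v ?linear0r.
  by split=> [|w wW]; rewrite ?memvD ?memvZ // linearPr /= u0 // v0 // mulr0 addr0.
have [N1 memN1] : exists N1 : {vspace V}, forall v,
    v \in N1 <-> v \in W /\ forall u, u \in N -> f u v = 0.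
  apply: vspace_of_closed => [|a u v [uW u0] [vW v0]].
    by split=> [|w _]; rewrite ?mem0v ?linear0r.
  by split=> [|w wN]; rewrite ?memvD ?memvZ // linearPr /= u0 // v0 // mulr0 addr0.
have NW : (N <= W)%VS by apply/subvP => v /memN[].
have N1W : (N1 <= W)%VS by apply/subvP => v /memN1[].
have NN1 : (N <= N1)%VS.
  apply/subvP => v /memN[vW v0]; apply/memN1; split=> // u /memN[uW _].
  exact: v0.
have [r [rW r_rad r_neq0]] :
    exists r, [/\ r \in W, forall w, w \in W -> f r w = 0 & r != 0].
  move/existsNP: ldegW => [r /not_implyP[rW /not_implyP[r0 /eqP]]].
  by exists r.
have [rN|rN] := boolP (r \in N).
  have [_ r_rad'] := (memN r).1 rN.
  by exists 1, (fun=> r); split=> //; split=> // i j; rewrite !ltnS !leqn0 => /eqP-> /eqP->;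
    rewrite r_rad.
have [rN1|rN1] := boolP (r \in N1); last first.
  have [z zN fzr] : exists2 z, z \in N & f z r = 1.
    have [r0|/existsNP[z /not_implyP[zN /eqP fzr]]] :=
        pselect (forall u, u \in N -> f u r = 0); first by case/negP: rN1; apply/memN1.
    exists ((f z r)^-1 *: z); first exact: memvZ.
    by rewrite linearZl_LR /= mulVf.
  have [zW fz] := (memN z).1 zN.
  exists 2, (fun i => if i is 0 then r else z); split=> //; split=> //.
  - by move=> [|[]].
  - by move=> [|[|//]] [|[|//]] _ _; rewrite ?r_rad ?fz ?fzr.
pose W' := (N1 :\: N)%VS.
have W'N1 : (W' <= N1)%VS := diffvSl N1 N.
have W'N : (N1 <= W' + N)%VS by rewrite addv_diff addvSl.
have W'capN : (W' :&: N = 0)%VS := capv_diff N1 N.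
(* N is nonzero by the symmetry of degeneracy, so W' is smaller than W. *)
have [z zN z_neq0] : exists2 z, z \in N & z != 0.
  apply: contrapT => noz; apply: ldegW; apply/nondegenerate_sym => v vW v0.
  apply/eqP/negP => /negP v_neq0; apply: noz; exists v => //.
  by apply/memN.
have ltW'W : (\dim W' < \dim W)%N.
  rewrite ltn_neqAle dimvS ?(subv_trans W'N1) // andbT.
  apply: contra z_neq0 => /eqP eqd; rewrite -memv0 -W'capN.
  have -> : W' = W by apply/eqP; rewrite eqEdim (subv_trans W'N1) // eqd leqnn.
  by apply/memv_capP; split; rewrite // (subvP NW).
have ldegW' : ~ left_nondegenerate f W'.
  have /memv_addP[r' r'W' [y yN def_r]] := subvP W'N _ rN1.
  move=> /(_ r' r'W') r'0; case/negP: rN; rewrite def_r r'0 ?add0r // => w wW'.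
  have wN1 := subvP W'N1 _ wW'; have wW := subvP N1W _ wN1.
  have := r_rad w wW; rewrite def_r linearDl /= => <-.
  by have [_ w0] := (memN1 w).1 wN1; rewrite (w0 y yN) addr0.
have [[|[|n]] [e [// _ che]]] := IH _ (leq_trans ltW'W leWk) ldegW'.
  by have [e' che'] := extend_singleton_chain memN memN1 W'N1 W'N W'capN che; exists 3, e'.
by have [e' che'] := extend_long_chain memN memN1 W'N1 W'N che; exists n.+4, e'.
Qed.

Lemma indecomposable_summand W P Q : indecomposable f W ->
    (P + Q = W)%VS -> (P :&: Q = 0)%VS ->
    (forall u v, u \in P -> v \in Q -> f u v = 0) ->
    (forall u v, u \in Q -> v \in P -> f u v = 0) ->
  P != 0%VS -> Q = 0%VS.
Proof.
move=> [_ indW] sumPQ capPQ PQ QP P0; apply/eqP/negP => /negP Q0; case: indW.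
exists (fun i : 'I_2 => if i == ord0 then P else Q).
split; last by move=> i; case: (i == ord0).
split.
- by rewrite !big_ord_recl big_ord0 /= addv0.
- rewrite directvE /= !big_ord_recl !big_ord0 /= addv0 addn0.
  by rewrite dimv_disjoint_sum.
- by move=> [[|[|//]] ?] [[|[|//]] ?].
Qed.

Lemma chain_singleton_gram W e : indecomposable f W ->
  jordan_chain f W 1 e -> has_jordan_gram f 1 W.
Proof.
move=> indW [/(_ 0 isT) eW e0 gram bot top _]; set r := e 0 in eW e0 bot top.
have sW : (<[r]> <= W)%VS by [].
have Q0 : (W :\: <[r]> = 0)%VS.
  apply: (indecomposable_summand indW (P := <[r]>%VS)).
  - by rewrite addvC addv_diff; apply/addv_idPl.
  - by rewrite capvC capv_diff.
  - move=> u v /vlineP[a ->] /(subvP (diffvSl _ _)) vW.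
    by rewrite linearZl_LR /= bot // mulr0.
  - move=> v u /(subvP (diffvSl _ _)) vW /vlineP[a ->].
    by rewrite linearZr_LR /= top // mulr0.
  - by rewrite -dimv_eq0 dim_vline e0.
have {Q0}eqW : W = <[r]>%VS.
  by apply/eqP; rewrite eqEsubv sW andbT -diffv_eq0 Q0.
exists [tuple r]; split.
  by rewrite /basis_of span_seq1 eqW eqxx seq1_free.
by apply/matrixP => i j; rewrite !ord1 !mxE /= gram.
Qed.

Section LongChain.
Variables (W : {vspace V}) (n : nat) (e : nat -> V).
Hypothesis che : jordan_chain f W n.+2 e.

(** The coordinate along e_i, read off from f: it is f(e_(i+1), .) except at the
    top of the chain, where only f(., e_(i-1)) is available. As a linear form it
    is defined on all of V. *)
Definition chain_coord i w := if i == n.+1 then f w (e n) else f (e i.+1) w.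

Lemma chain_coordP i : scalar (chain_coord i).
Proof.
by move=> a u v; rewrite /chain_coord; case: ifP; rewrite ?linearPl ?linearPr.
Qed.

HB.instance Definition _ i :=
  GRing.isLinear.Build F V F *%R (chain_coord i) (chain_coordP i).

Lemma chain_coordE i j : (i < n.+2)%N -> (j < n.+2)%N ->
  chain_coord i (e j) = (i == j)%:R.
Proof.
move=> lti ltj; rewrite /chain_coord; case: ifP => [/eqP->|neqi].
  by rewrite (chain_gram che) // eq_sym.
by rewrite (chain_gram che) // ltn_neqAle eqSS neqi.
Qed.

Lemma chain_coord_sum (k : 'I_n.+2 -> F) (i : 'I_n.+2) :
  chain_coord i (\sum_j k j *: e j) = k i.
Proof.
rewrite linear_sum (eq_bigr (fun j => k j * (i == j)%:R)); last first.
  by move=> j _; rewrite linearZ_LR; congr (_ * _); apply: chain_coordE.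
rewrite (bigD1 i) //= eqxx mulr1 big1 ?addr0 // => j.
by rewrite eq_sym => /negPf->; rewrite mulr0.
Qed.

Lemma chain_left_coord i w : w \in W -> (i < n.+2)%N ->
  f (e i) w = if i is k.+1 then chain_coord k w else 0.
Proof.
case: i => [|k] wW lti; first exact: chain_bottom che w wW.
by rewrite /chain_coord ltn_eqF.
Qed.

Lemma chain_right_coord i w : w \in W -> (i < n.+2)%N ->
  f w (e i) = if i == n.+1 then 0 else chain_coord i.+1 w.
Proof.
move=> wW lti; case: ifP => [/eqP->|neqi]; first exact: chain_top che w wW.
rewrite /chain_coord eqSS; case: ifP => [/eqP->//|neqi'].
by rewrite (chain_step che) //; lia.
Qed.

(** Every form f(e_i, .) or f(., e_i) on W is zero or one of the coordinates, so
    the common kernel Q of the coordinates is an orthogonal complement of the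
    span of the chain; indecomposability makes it zero. *)
Lemma chain_long_gram : indecomposable f W -> has_jordan_gram f n.+2 W.
Proof.
move=> indW.
have [X XE] : exists X : n.+2.-tuple V, forall i : 'I_n.+2, X`_i = e i.
  by exists [tuple e i | i < n.+2] => i; rewrite -tnth_nth tnth_mktuple.
have sumX (k : 'I_n.+2 -> F) : \sum_i k i *: X`_i = \sum_i k i *: e i.
  by apply: eq_bigr => i _; rewrite XE.
have freeX : free X.
  apply/freeP => k; rewrite sumX => k0 i.
  by rewrite -(chain_coord_sum k i) k0 linear0.
have memX (k : 'I_n.+2 -> F) : \sum_i k i *: X`_i \in <<X>>%VS.
  by apply: memv_suml => i _; rewrite memvZ // memv_span // mem_nth // size_tuple.
have XW : (<<X>> <= W)%VS.
  apply/subvP => w wX; rewrite (coord_span wX) sumX; apply: memv_suml => i _.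
  by rewrite memvZ // (chain_mem che).
have [Q memQ] : exists Q : {vspace V}, forall v,
    v \in Q <-> v \in W /\ forall i, (i < n.+2)%N -> chain_coord i v = 0.
  apply: vspace_of_closed => [|a u v [uW u0] [vW v0]].
    by split=> [|w _]; rewrite ?mem0v ?linear0.
  by split=> [|w wN]; rewrite ?memvD ?memvZ // linearP /= u0 // v0 // mulr0 addr0.
have QW : (Q <= W)%VS by apply/subvP => v /memQ[].
have splitX w : w \in W -> exists2 p, p \in <<X>>%VS & w - p \in Q.
  move=> wW; pose p := \sum_(i < n.+2) chain_coord i w *: X`_i.
  exists p; rewrite ?memX //; apply/memQ; split; first by rewrite memvB // (subvP XW) ?memX.
  move=> i lti; rewrite linearB /= /p sumX.
  by rewrite (chain_coord_sum (fun j => chain_coord j w) (Ordinal lti)) subrr.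
have Q0 : Q = 0%VS.
  apply: (indecomposable_summand indW (P := <<X>>%VS)).
  - apply/eqP; rewrite eqEsubv subv_add XW QW /=; apply/subvP => w wW.
    have [p pX wpQ] := splitX w wW.
    by rewrite -(subrK p w) addrC memv_add.
  - apply/eqP; rewrite -subv0; apply/subvP => w /memv_capP[wX /memQ[_ w0]].
    rewrite (coord_span wX) big1 ?mem0v // => i _.
    rewrite -(chain_coord_sum (fun j => coord X j w) i) -sumX -(coord_span wX).
    by rewrite w0 ?scale0r.
  - move=> u w uX /memQ[wW w0]; rewrite (coord_span uX) linear_sumlz big1 // => i _.
    rewrite linearZl_LR XE chain_left_coord //.
    by case: (val i) (ltn_ord i) => [|k] ltk; rewrite ?mulr0 //= w0 ?mulr0 // ltnW.
  - move=> w u /memQ[wW w0] uX; rewrite (coord_span uX) linear_sumr big1 // => i _.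
    rewrite linearZr_LR XE chain_right_coord //.
    case: ifP => neqi; first by rewrite /= mulr0.
    by rewrite w0 /= ?mulr0 // ltn_neqAle eqSS neqi ltn_ord.
  - apply: contraNneq (chain_neq0 che) => X0.
    by rewrite -memv0 -X0 -(XE ord0) memv_span // mem_nth // size_tuple.
have eqW : <<X>>%VS = W.
  apply/eqP; rewrite eqEsubv XW /=; apply/subvP => w wW.
  by have [p pX] := splitX w wW; rewrite Q0 memv0 subr_eq0 => /eqP->.
exists X; split; first by rewrite /basis_of eqW eqxx.
apply/matrixP => i j; rewrite !mxE !XE; exact: (chain_gram che).
Qed.

End LongChain.

(** The degenerate case of Gabriel's classification of bilinear forms. *)
Lemma indecomposable_nondegenerate W : indecomposable f W ->
  (forall n, ~ has_jordan_gram f n W) -> left_nondegenerate f W.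
Proof.
move=> indW noJ; apply: contrapT => /exists_jordan_chain[[|[|n]] [e [// _ che]]].
  exact: (noJ 1) (chain_singleton_gram indW che).
exact: (noJ n.+2) (chain_long_gram che indW).
Qed.

End Classification.

(** * Lie ideals, images and direct sums *)

Section LieProducts.
Variables (F : fieldType) (L : lieAlgType F).
Implicit Types A B C I : {vspace L}.

Lemma lieC (x y : L) : lie x y = - lie y x.
Proof.
apply/eqP; rewrite -addr_eq0; apply/eqP.
have := liexx (x + y); rewrite linearDl !linearDr /= !liexx add0r addr0.
by [].
Qed.

Lemma lie_prod_min A B C :
  (forall a b, a \in A -> b \in B -> lie a b \in C) -> (lie_prod A B <= C)%VS.
Proof.
move=> ABC; apply/span_subvP => _ /allpairsP[[a b] /= [aA bB ->]].
by apply: ABC; apply: vbasis_mem.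
Qed.

Lemma lie_prodS A A' B B' :
  (A <= A')%VS -> (B <= B')%VS -> (lie_prod A B <= lie_prod A' B')%VS.
Proof.
move=> sA sB; apply: lie_prod_min => a b /(subvP sA) aA /(subvP sB) bB.
exact: memv_lie.
Qed.

(** By the Jacobi identity, ad x is a derivation. *)
Lemma lie_ideal_prod I : lie_ideal I -> lie_ideal (lie_prod I I).
Proof.
move=> idI x.
have [W memW] : exists W : {vspace L}, forall y,
    y \in W <-> lie x y \in lie_prod I I.
  apply: vspace_of_closed => [|a u v uI vI]; first by rewrite linear0r mem0v.
  by rewrite linearPr /= memvD ?memvZ.
suff sW : (lie_prod I I <= W)%VS by move=> y /(subvP sW)/memW.
apply: lie_prod_min => a b aI bI; apply/memW.
have /eqP := lie_jacobi x a b; rewrite -addrA addr_eq0 => /eqP->.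
rewrite memvN memvD // memv_lie //; last exact: idI.
by rewrite lieC memvN idI.
Qed.

Lemma lie_ideal_derived I k : lie_ideal I -> lie_ideal (derived_series I k).
Proof. by move=> idI; elim: k => //= k IH; apply: lie_ideal_prod. Qed.

End LieProducts.

Section LieMorphism.
Variables (F : fieldType) (L M : lieAlgType F) (phi : {linear L -> M}).
Hypothesis phi_lie : {morph phi : x y / lie x y}.

Lemma derived_series_img A k :
  (derived_series (linfun phi @: A) k <= linfun phi @: derived_series A k)%VS.
Proof.
elim: k => [|k IH] //=; apply: subv_trans (lie_prodS IH IH) _.
apply: lie_prod_min => _ _ /memv_imgP[a aA ->] /memv_imgP[b bA ->].
by rewrite !lfunE /= -phi_lie -(lfunE phi) memv_img // memv_lie.
Qed.

Lemma solvable_img A : lie_solvable A -> lie_solvable (linfun phi @: A).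
Proof.
move=> [k Ak0]; exists k; apply/eqP; rewrite -subv0.
by rewrite (subv_trans (derived_series_img A k)) // Ak0 limg0.
Qed.

Lemma ideal_img A : (forall y, exists x, phi x = y) ->
  lie_ideal A -> lie_ideal (linfun phi @: A).
Proof.
move=> phi_surj idA y _ /memv_imgP[a aA ->]; have [x <-] := phi_surj y.
by rewrite lfunE /= -phi_lie -(lfunE phi) memv_img // idA.
Qed.

End LieMorphism.

Lemma lie_isomorphic_sym (F : fieldType) (L M : lieAlgType F) :
  lie_isomorphic L M -> lie_isomorphic M L.
Proof.
move=> [phi [[psi phiK psiK] phi_lie]].
have psi_lin : linear psi.
  by move=> a u v; apply: (can_inj phiK); rewrite linearP !psiK.
pose Lpsi := GRing.isLinear.Build F M L *:%R psi psi_lin.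
pose psiL : {linear M -> L} := HB.pack psi Lpsi.
exists psiL; split; first by exists phi.
by move=> x y; apply: (can_inj phiK); rewrite phi_lie /= !psiK.
Qed.

Lemma reductive_isomorphic (F : fieldType) (L M : lieAlgType F) :
  lie_isomorphic L M -> reductive M -> reductive L.
Proof.
move=> [phi [[psi phiK psiK] phi_lie]] redM I idI solI x y xI.
apply: (can_inj phiK); rewrite phi_lie linear0.
apply: (redM (linfun phi @: I)%VS).
- by apply: ideal_img => // z; exists (psi z).
- exact: solvable_img.
- by rewrite -(lfunE phi) memv_img.
Qed.

(** The third hypothesis says that the image of L is an ideal on which M acts by
    inner derivations of L, as happens for a direct summand; thus ideals of L
    are ideals of M. *)
Lemma reductive_ideal (F : fieldType) (L M : lieAlgType F)
    (i : {linear L -> M}) :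
    {morph i : x y / lie x y} -> injective i ->
    (forall z, exists b, forall x, lie z (i x) = i (lie b x)) ->
  reductive M -> reductive L.
Proof.
move=> i_lie i_inj i_ideal red I idI solI x y xI.
apply: i_inj; rewrite i_lie linear0; apply: (red (linfun i @: I)%VS).
- move=> z _ /memv_imgP[a aI ->]; have [b zb] := i_ideal z.
  by rewrite lfunE zb -(lfunE i) memv_img // idI.
- exact: solvable_img.
- by rewrite -(lfunE i) memv_img.
Qed.

Section LieSumReductive.
Variables (F : fieldType) (L M : lieAlgType F).

Lemma reductive_sum : reductive L -> reductive M -> reductive (L * M)%type.
Proof.
move=> redL redM I idI solI x y xI.
have fst_lie : {morph (fst : {linear (L * M)%type -> L}) : x y / lie x y} by [].
have snd_lie : {morph (snd : {linear (L * M)%type -> M}) : x y / lie x y} by [].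
congr pair.
- apply: (redL (linfun (fst : {linear (L * M)%type -> L}) @: I)%VS).
  + by apply: ideal_img => // z; exists (z, 0).
  + exact: solvable_img.
  + by apply/memv_imgP; exists x; rewrite ?lfunE.
- apply: (redM (linfun (snd : {linear (L * M)%type -> M}) @: I)%VS).
  + by apply: ideal_img => // z; exists (0, z).
  + exact: solvable_img.
  + by apply/memv_imgP; exists x; rewrite ?lfunE.
Qed.

Fact inl_linear : linear (fun x : L => (x, 0 : M)).
Proof. by move=> a u v; congr pair; rewrite /= ?scaler0 ?addr0. Qed.
Fact inr_linear : linear (fun x : M => (0 : L, x)).
Proof. by move=> a u v; congr pair; rewrite /= ?scaler0 ?addr0. Qed.

Lemma reductive_suml : reductive (L * M)%type -> reductive L.
Proof.
pose iB := GRing.isLinear.Build F L (L * M)%type *:%R _ inl_linear.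
pose i : {linear L -> (L * M)%type} := HB.pack (fun x : L => (x, 0 : M)) iB.
apply: (reductive_ideal (i := i)) => [x y|x y []//|[a b]].
  by congr pair; rewrite /= liexx.
by exists a => x; congr pair; rewrite /= linear0r.
Qed.

Lemma reductive_sumr : reductive (L * M)%type -> reductive M.
Proof.
pose iB := GRing.isLinear.Build F M (L * M)%type *:%R _ inr_linear.
pose i : {linear M -> (L * M)%type} := HB.pack (fun x : M => (0 : L, x)) iB.
apply: (reductive_ideal (i := i)) => [x y|x y []//|[a b]].
  by congr pair; rewrite /= liexx.
by exists b => x; congr pair; rewrite /= linear0r.
Qed.

End LieSumReductive.

(** * Reductivity of matrix Lie algebras *)

Section GeneralLinear.
Variables (F : fieldType).
Hypothesis charF : 2%N \notin [pchar F].

Lemma two_neq0 : 2%:R != 0 :> F.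
Proof. by apply: contra charF => two0; rewrite inE /= two0. Qed.

Variable n : nat.
Implicit Types (A : 'M[F]_n) (i j : 'I_n).

(** If A has a nonzero entry at (i, j) off the diagonal, then with E = E_ji one has
    [E, [E, A]] = - 2 E A E, a nonzero multiple of E. Otherwise A is diagonal,
    and two distinct diagonal entries i, j give [A, E_ij] as a nonzero multiple
    of E_ij. What remains is a scalar matrix, which is central. *)
Lemma ideal_offdiag (I : {vspace 'M[F]_n}) A B : lie_ideal I -> A \in I ->
  lie A B != 0 -> exists i j, i != j /\ delta_mx i j \in I.
Proof.
move=> idI AI; apply: contra_neqP => noE.
have E_notin i j : i != j -> delta_mx i j \notin I.
  by move=> neq; apply/negP => Eij; apply: noE; exists i, j.
have A0 i j : i != j -> A i j = 0.
  move=> neq; apply/eqP; apply: contraTT (E_notin j i _); last by rewrite eq_sym.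
  move=> Aij0; rewrite negbK.
  pose E : 'M[F]_n := delta_mx j i.
  have EAE : E *m A *m E = A i j *: E.
    have defE : E = delta_mx j (0 : 'I_1) *m delta_mx 0 i by rewrite mul_delta_mx.
    have Aij : delta_mx (0 : 'I_1) i *m A *m delta_mx j (0 : 'I_1) = (A i j)%:M.
      by rewrite -rowE -colE; apply/matrixP => k l; rewrite !ord1 !mxE.
    transitivity (delta_mx j (0 : 'I_1) *m
        (delta_mx (0 : 'I_1) i *m A *m delta_mx j (0 : 'I_1)) *m delta_mx 0 i).
      by rewrite defE !mulmxA.
    by rewrite Aij mul_mx_scalar -scalemxAl -defE.
  have EE : E *m E = 0 by rewrite mul_delta_mx_0 // eq_sym.
  have : lie E (lie E A) = (- 2%:R * A i j) *: E.
    rewrite /lie /= /mx_lie mulmxBr mulmxBl !mulmxA EE mul0mx sub0r.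
    rewrite -[A *m E *m E]mulmxA EE mulmx0 subr0 EAE.
    by rewrite -opprD -scalerDl -scaleNr mulNr mulr_natl mulr2n.
  move=> eqE; rewrite -[delta_mx _ _](scalerK (a := - 2%:R * A i j)).
    by rewrite memvZ // -eqE !idI.
  by rewrite mulf_neq0 // oppr_eq0 two_neq0.
have Adiag : A = diag_mx (\row_i A i i).
  apply/matrixP => i j; rewrite !mxE; have [->|neq] := eqVneq i j; first by [].
  by rewrite A0.
have Aeq i j : A i i = A j j.
  have [->//|neq] := eqVneq i j.
  apply/eqP; rewrite -subr_eq0; apply: contraTT (E_notin _ _ neq) => neqA.
  rewrite negbK -[delta_mx _ _](scalerK neqA) memvZ //.
  have -> : (A i i - A j j) *: delta_mx i j = lie A (delta_mx i j) :> 'M[F]_n.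
    rewrite /lie /= /mx_lie {3 4}Adiag.
    rewrite mul_diag_mx mul_mx_diag.
    apply/matrixP => k l; rewrite !mxE.
    have [->|nk] := eqVneq k i; last by rewrite /= !mulr0 mul0r subrr.
    have [->|nl] := eqVneq l j; last by rewrite /= !mulr0 mul0r subrr.
    by rewrite /= !mulr1 mul1r.
  by rewrite lieC memvN idI.
case: n A B {AI} A0 Adiag Aeq => [|m] A' B' A0 Adiag Aeq.
  by apply/matrixP => [[]].
have -> : A' = (A' ord0 ord0)%:M.
  apply/matrixP => i j; rewrite mxE; have [->|neq] := eqVneq i j; last by rewrite A0.
  by rewrite (Aeq j ord0).
by rewrite /lie /= /mx_lie scalar_mxC subrr.
Qed.

(** The derived series consists of ideals, so once E_ij lies in a term, so does
    [E_ij, E_ji], and the bracket of the two is 2 E_ij. *)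
Lemma derived_offdiag (I : {vspace 'M[F]_n}) i j k : i != j -> lie_ideal I ->
  delta_mx i j \in I -> delta_mx i j \in derived_series I k.
Proof.
move=> neq idI EI; elim: k => //= k EIk; set D := derived_series I k in EIk *.
pose E : 'M[F]_n := delta_mx i j; pose G : 'M[F]_n := delta_mx j i.
have idD : lie_ideal D by apply: lie_ideal_derived.
have HD : lie E G \in D by rewrite lieC memvN idD.
have : lie (lie E G) E = 2%:R *: E.
  rewrite /lie /= /mx_lie /E /G !mul_delta_mx mulmxBl mulmxBr !mul_delta_mx.
  rewrite !mul_delta_mx_0 // 1?eq_sym // subr0 sub0r opprK.
  by rewrite scaler_nat mulr2n.
by move=> eqE; rewrite -[delta_mx _ _](scalerK two_neq0) memvZ // -eqE memv_lie.
Qed.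

Lemma reductive_mx : reductive 'M[F]_n.
Proof.
move=> I idI [k Ik0] A B AI; apply/eqP; apply: contraT => AB.
have [i [j [neq EI]]] := ideal_offdiag idI AI AB.
have := derived_offdiag k neq idI EI; rewrite Ik0 memv0.
move=> /eqP/matrixP/(_ i j)/eqP; rewrite !mxE !eqxx /= oner_eq0.
by [].
Qed.

End GeneralLinear.

(** * Descending vectors *)

Section Descent.
Variables (F : fieldType) (V : vectType F).

(** This is defined for an arbitrary function so that it applies equally to a form
    and to its transpose. *)
Fixpoint descends (g : V -> V -> F) (k : nat) (v : V) : Prop :=
  if k is k'.+1 then exists2 u, forall w, g v w = g w u & descends g k' u
  else v = 0.

Lemma descends_skew (g : V -> V -> F) (y : 'End(V)) k v :
    (forall v w, g (y v) w = - g v (y w)) ->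
  descends g k v -> descends g k (y v).
Proof.
move=> skew; elim: k v => [v ->|k IH v [u vu uk]]; first exact: linear0.
by exists (y u); [move=> w; rewrite skew vu skew opprK | exact: IH].
Qed.

Variable f : {biscalar V}.

Lemma descends0 k : descends f k 0.
Proof. by elim: k => //= k IH; exists 0 => // w; rewrite linear0l linear0r. Qed.

Lemma descendsP k a u v :
  descends f k u -> descends f k v -> descends f k (a *: u + v).
Proof.
elim: k u v => [u v -> ->|k IH u v [u' uu' ku'] [v' vv' kv']] /=.
  by rewrite scaler0 addr0.
by exists (a *: u' + v'); [move=> w; rewrite linearPl linearPr /= uu' vv' | exact: IH].
Qed.

Lemma descends_leq j k v : (j <= k)%N -> descends f j v -> descends f k v.
Proof.
elim: j k v => [|j IH] [|k] v //= lejk; first by move=> ->; apply: (descends0 k.+1).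
by move=> [u vu uj]; exists u => //; apply: IH uj.
Qed.

(** Moving both arguments one step down preserves the value:
    f(u, v) = f(v, u') = f(u', v'). *)
Lemma descends_isotropic j k u v :
  descends f j u -> descends f k v -> f u v = 0.
Proof.
elim: j k u v => [|j IH] [|k] u v /=; try by move=> -> _; rewrite linear0l.
  by move=> _ ->; rewrite linear0r.
by move=> [u' uu' ju'] [v' vv' kv']; rewrite uu' vv'; apply: IH ju' kv'.
Qed.

Lemma descending_space : exists M : {vspace V},
  forall v, v \in M <-> exists k, descends f k v.
Proof.
apply: vspace_of_closed => [|a u v [k ku] [j jv]]; first by exists 0.
exists (maxn k j); apply: descendsP.
  by apply: descends_leq ku; apply: leq_maxl.
by apply: descends_leq jv; apply: leq_maxr.
Qed.

Lemma chain_descends n e j : jordan_chain f {:V} n e -> (j.*2 < n)%N ->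
  descends f j.+1 (e j.*2).
Proof.
move=> che; elim: j => [_|j IH ltj] /=.
  by exists 0 => // w; rewrite linear0r (chain_bottom che) ?memvf.
exists (e j.*2) => [w|]; first by rewrite (chain_step che) ?memvf.
by apply: IH; apply: ltn_trans ltj; rewrite doubleS leqW.
Qed.

End Descent.

(** * Odd blocks obstruct reductivity *)

Section NonReductive.
Variables (F : fieldType) (V : vectType F) (f : {biscalar V}).
Implicit Types (x h : 'End(V)).

Definition skew_adjoint x := forall v w, f (x v) w = - f v (x w).

Lemma form_lieP (y : form_lie f) : skew_adjoint (vsval y).
Proof. by apply/form_lie_spaceP; apply: subvsP. Qed.

Lemma form_lieE (y z : form_lie f) v :
  vsval (lie y z) v = vsval y (vsval z v) - vsval z (vsval y v).
Proof. by rewrite /= !lfunE /= !lfunE /= !lfunE. Qed.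

(** The conditions on x define an abelian ideal of L(f), because L(f) preserves the
    space M of descending vectors. *)
Lemma reductive_commutes x h (M : {vspace V}) :
    (forall v, v \in M <-> exists k, descends f k v) ->
    reductive (form_lie f) -> skew_adjoint x -> skew_adjoint h ->
    (forall v, x v \in M) -> (forall u, u \in M -> x u = 0) ->
  forall v, x (h v) = h (x v).
Proof.
move=> memM red skx skh xVM xM0 v.
have Minv (z : form_lie f) u : u \in M -> vsval z u \in M.
  move=> /memM[k ku]; apply/memM; exists k; apply: descends_skew ku.
  exact: form_lieP.
have [I memI] : exists I : {vspace form_lie f}, forall y, y \in I <->
    (forall v, vsval y v \in M) /\ (forall u, u \in M -> vsval y u = 0).
  apply: vspace_of_closed => [|a y z [yV yM] [zV zM]].
    by split=> w; rewrite linear0 lfunE //= mem0v.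
  split=> w; first by rewrite linearP /= !lfunE /= lfunE /= memvD ?memvZ.
  by move=> wM; rewrite linearP /= !lfunE /= lfunE /= yM // zM // scaler0 addr0.
have idI : lie_ideal I.
  move=> z y /memI[yV yM]; apply/memI; split=> u.
    by rewrite form_lieE memvB // Minv.
  by move=> uM; rewrite form_lieE yM // linear0 yM ?subr0 ?Minv.
have solI : lie_solvable I.
  exists 1; apply/eqP; rewrite -subv0 /=; apply: lie_prod_min => a b.
  move=> /memI[aV aM] /memI[bV bM]; rewrite memv0; apply/eqP/val_inj/lfunP => u.
  by rewrite form_lieE aM // bM // subrr linear0 lfunE.
have x_in : x \in form_lie_space f by apply/form_lie_spaceP.
have h_in : h \in form_lie_space f by apply/form_lie_spaceP.
have xI : Subvs x_in \in I by apply/memI.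
have := red I idI solI (Subvs x_in) (Subvs h_in) xI.
move=> /(congr1 (fun y : form_lie f => vsval y v)); rewrite form_lieE linear0 lfunE /=.
by move/eqP; rewrite subr_eq0 => /eqP.
Qed.

(** With c_j = e_(2j) for 0 <= j <= K, the relations read f(., c_j) = f(c_(j+1), .)
    for j < K, f(c_0, .) = 0 and f(., c_K) = 0; this makes the skewness of x a
    telescoping sum. The element h lies in L(f) because f only pairs vectors
    e_i of opposite parity. Evaluating at e_1, where x(e_1) = e_2 - e_0, shows
    that x and h do not commute. *)
Lemma odd_chain_not_reductive n e : 2%N \notin [pchar F] -> odd n ->
  jordan_chain f {:V} n.+2 e -> ~ reductive (form_lie f).
Proof.
move=> charF oddn che red.
have [M memM] := descending_space f.
pose K := (n.+1)./2; have defn : n.+2 = K.*2.+1.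
  by rewrite /K -[in LHS](odd_double_half n.+1) /= oddn.
have K_gt0 : (0 < K)%N by move: defn; case: (K).
have c_in j : (j <= K)%N -> e j.*2 \in M.
  by move=> lejK; apply/memM; exists j.+1; apply: chain_descends che _; lia.
have M_iso u v : u \in M -> v \in M -> f u v = 0.
  by move=> /memM[j ju] /memM[k kv]; apply: descends_isotropic ju kv.
pose x0 u := \sum_(j < K) f (e j.+1.*2) u *: (e j.+1.*2 - e j.*2).
have x_lin : linear x0.
  move=> a u v; rewrite scaler_sumr -big_split; apply: eq_bigr => j _ /=.
  by rewrite linearPr scalerDl scalerA.
have [x xE] := lfun_of_linear x_lin.
pose h0 u := \sum_(i < n.+2) ((-1) ^+ i * chain_coord f n e i u) *: e i.
have h_lin : linear h0.
  move=> a u v; rewrite scaler_sumr -big_split; apply: eq_bigr => j _ /=.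
  by rewrite chain_coordP mulrDr scalerDl scalerA mulrCA.
have [h hE] := lfun_of_linear h_lin.
have skx : skew_adjoint x.
  move=> u w; apply/eqP; rewrite -addr_eq0 !xE linear_sumlz linear_sumr -big_split /=.
  (* Truncating at K makes f(v, c_j) = al v (j + 1) valid for j = K as well. *)
  pose al v j := if (j <= K)%N then f (e j.*2) v else 0.
  have alE v j : (j <= K)%N -> f (e j.*2) v = al v j by rewrite /al => ->.
  have alS v j : (j <= K)%N -> f v (e j.*2) = al v j.+1.
    move=> lejK; rewrite /al; case: ltnP => [ltjK|leKj].
      by rewrite doubleS (chain_step che) ?memvf // defn; lia.
    have -> : j.*2 = n.+1 by lia.
    by rewrite (chain_top che (memvf v)).
  pose T j := al w j * al u j.+1.
  rewrite (eq_bigr (fun j : 'I_K => T j.+1 - T j)) => [|j _].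
    rewrite -(big_mkord xpredT (fun j => T j.+1 - T j)) telescope_sumr //.
    rewrite /T /al leq0n ltnn mulr0 (chain_bottom che) ?memvf //.
    by rewrite mul0r subrr.
  have ltj := ltn_ord j.
  rewrite linearZl_LR linearZr_LR linearBl linearBr /= !alE ?(ltnW ltj) // !alS ?(ltnW ltj) //.
  by rewrite /T; ring.
have skh : skew_adjoint h.
  move=> u w; pose k i v := chain_coord f n e i v.
  have -> : f (h u) w = \sum_(i < n.+1) (-1) ^+ i.+1 * k i.+1 u * k i w.
    rewrite hE linear_sumlz big_ord_recl linearZl_LR (chain_left_coord che) ?memvf //=.
    rewrite mulr0 add0r; apply: eq_bigr => i _; rewrite linearZl_LR /=.
    by rewrite (chain_left_coord che) ?memvf // /bump /= ltnS.
  have -> : f u (h w) = \sum_(i < n.+1) (-1) ^+ i * k i w * k i.+1 u.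
    rewrite hE linear_sumr big_ord_recr linearZr_LR (chain_right_coord che) ?memvf //=.
    rewrite eqxx mulr0 addr0; apply: eq_bigr => i _; rewrite linearZr_LR /=.
    by rewrite (chain_right_coord che) ?memvf ?ltn_eqF // ltnW // ltnS.
  by rewrite -sumrN; apply: eq_bigr => i _; rewrite exprS; ring.
have x1 : x (e 1) = e 2 - e 0.
  rewrite xE /x0; case: K K_gt0 defn {c_in x0 x_lin x xE skx} => // K' _ defn.
  rewrite big_ord_recl (chain_gram che) //; last by rewrite defn.
  rewrite (_ : ord0.+1.*2 = 2%N) // eqxx scale1r big1 ?addr0 // => j _.
  have ltj := ltn_ord j; rewrite lift0 (chain_gram che) //; last by rewrite defn; lia.
  by rewrite !doubleS scale0r.
have he i : (i < n.+2)%N -> h (e i) = (-1) ^+ i *: e i.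
  move=> lti; rewrite hE /h0 (bigD1 (Ordinal lti)) //= (chain_coordE che) // eqxx mulr1.
  rewrite big1 ?addr0 // => j neqj.
  by rewrite (chain_coordE che) // (negPf neqj : (j == i :> nat) = false) mulr0 scale0r.
have xVM v : x v \in M.
  rewrite xE memv_suml // => j _; have ltj := ltn_ord j.
  by rewrite memvZ // memvB ?c_in // ltnW.
have xM0 u : u \in M -> x u = 0.
  move=> uM; rewrite xE /x0 big1 // => j _.
  by rewrite M_iso ?scale0r // c_in.
have := reductive_commutes memM red skx skh xVM xM0 (e 1).
rewrite he // expr1 scaleN1r linearN /= x1 [h (_ - _)]linearB /= !he //; last first.
  by case: (n) oddn.
rewrite expr0 expr2 mulrNN mulr1 !scale1r => /eqP.
rewrite eq_sym -subr_eq0 opprK -mulr2n -scaler_nat scaler_eq0 (negPf (two_neq0 charF)).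
rewrite subr_eq0 => /eqP e20.
have : f (e 2) (e 1) = f (e 0) (e 1) by rewrite e20.
rewrite !(chain_gram che) //; last by case: (n) oddn.
by move=> /eqP; rewrite oner_eq0.
Qed.

Lemma separating_functional (M : {vspace V}) v : v \notin M ->
  exists phi : {scalar V}, (forall u, u \in M -> phi u = 0) /\ phi v = 1.
Proof.
move=> vM; pose pi u := u - projv M u.
have piv_neq0 : pi v != 0.
  by apply: contraNneq vM => /subr0_eq->; apply: memv_proj.
have [i ci] : exists i, coord (vbasis {:V}) i (pi v) != 0.
  apply: contrapT => noi; case/eqP: piv_neq0.
  rewrite (coord_vbasis (memvf (pi v))) big1 // => i _.
  have [->|ci] := eqVneq (coord (vbasis {:V}) i (pi v)) 0; first by rewrite scale0r.
  by case: noi; exists i.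
pose phi u := (coord (vbasis {:V}) i (pi v))^-1 * coord (vbasis {:V}) i (pi u).
have phi_lin : scalar phi.
  move=> a u w; rewrite /phi /pi linearP opprD addrACA -scalerBr linearP /=.
  by rewrite mulrDr mulrCA.
pose phiL : {scalar V} := HB.pack phi (GRing.isLinear.Build F V F *%R phi phi_lin).
exists phiL; split=> /=.
  by move=> u uM; rewrite /phi /pi (projv_id uM) subrr linear0 mulr0.
by rewrite /phi mulVf.
Qed.

(** The space M of descending vectors contains r, and it is not all of V because f
    vanishes on M. The maps u |-> phi(u) r lie in L(f) for every linear form
    phi, as r is orthogonal to everything. *)
Lemma radical_not_reductive r : r != 0 ->
    (forall v, f r v = 0) -> (forall v, f v r = 0) ->
  (exists u v, f u v != 0) -> ~ reductive (form_lie f).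
Proof.
move=> r0 rl rr [a [b fab]] red.
have [M memM] := descending_space f.
have rM : r \in M.
  by apply/memM; exists 1, 0 => // w; rewrite rl linear0r.
have [v vM] : exists v, v \notin M.
  apply: contrapT => noM; case/eqP: fab.
  have M_full u : u \in M by apply: contraT => uM; case: noM; exists u.
  have [[k ka] [j jb]] := ((memM a).1 (M_full a), (memM b).1 (M_full b)).
  exact: descends_isotropic ka jb.
have [phi [phiM phiv]] := separating_functional vM.
have rN0 : r \notin 0%VS by rewrite memv0.
have [psi [_ psir]] := separating_functional rN0.
have lin (chi : {scalar V}) : linear (fun u => chi u *: r).
  by move=> c u w; rewrite linearP /= scalerDl scalerA.
have [[x xE] [h hE]] := (lfun_of_linear (lin phi), lfun_of_linear (lin psi)).
have skx : skew_adjoint x.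
  by move=> u w; rewrite !xE linearZl_LR linearZr_LR /= rl rr !mulr0 oppr0.
have skh : skew_adjoint h.
  by move=> u w; rewrite !hE linearZl_LR linearZr_LR /= rl rr !mulr0 oppr0.
have xVM u : x u \in M by rewrite xE memvZ.
have xM0 u : u \in M -> x u = 0 by move=> uM; rewrite xE phiM // scale0r.
have := reductive_commutes memM red skx skh xVM xM0 v.
rewrite xM0; last by rewrite hE memvZ.
by rewrite xE hE phiv scale1r psir scale1r => /eqP; rewrite eq_sym (negPf r0).
Qed.

End NonReductive.

(** * The Lie algebra of the zero form *)

Section ZeroForm.
Variables (F : fieldType) (V : vectType F) (f : {biscalar V}).
Hypothesis f0 : forall u v, f u v = 0.
Let b := vbasis {:V}.

Definition end_mx (y : form_lie f) : 'M[F]_(\dim {:V}) :=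
  \matrix_(i, j) coord b i (vsval y b`_j).

Fact end_mx_linear : linear end_mx.
Proof.
by move=> a y z; apply/matrixP => i j; rewrite !mxE linearP /= !lfunE /= lfunE linearP.
Qed.

HB.instance Definition _ := GRing.isLinear.Build F (form_lie f)
  'M[F]_(\dim {:V}) *:%R end_mx end_mx_linear.

Lemma zero_form_lie_isomorphic :
  lie_isomorphic (form_lie f) 'M[F]_(\dim {:V}).
Proof.
exists end_mx; split.
  apply: injective_surjective_bij => [y z eq_yz|A].
    apply/val_inj/lfunP => v; rewrite (coord_vbasis (memvf v)) !linear_sum.
    apply: eq_bigr => j _; rewrite !linearZ /=; congr (_ *: _).
    rewrite [LHS](coord_vbasis (memvf _)) [RHS](coord_vbasis (memvf _)).
    apply: eq_bigr => i _; congr (_ *: _).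
    by move/matrixP: eq_yz => /(_ i j); rewrite !mxE.
  have y_lin : linear (fun v => \sum_i (\sum_j A i j * coord b j v) *: b`_i).
    move=> a u v; rewrite scaler_sumr -big_split; apply: eq_bigr => i _ /=.
    rewrite scalerA -scalerDl; congr (_ *: _); rewrite mulr_sumr -big_split.
    by apply: eq_bigr => j _; rewrite linearP /=; ring.
  have [y yE] := lfun_of_linear y_lin.
  have y_in : y \in form_lie_space f.
    by apply/form_lie_spaceP => v w; rewrite !f0 oppr0.
  exists (Subvs y_in); apply/matrixP => i j; rewrite mxE /= yE.
  rewrite coord_sum_free ?(basis_free (vbasisP _)) // (bigD1 j) //=.
  rewrite coord_free ?(basis_free (vbasisP _)) // eqxx mulr1 big1 ?addr0 // => k neqk.
  by rewrite coord_free ?(basis_free (vbasisP _)) // ?[j == k]eq_sym (negPf neqk) mulr0.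
move=> y z; apply/matrixP => i j; rewrite !mxE form_lieE linearB /=.
have coord_comp (s t : 'End(V)) : coord b i (s (t b`_j))
    = \sum_(k < \dim {:V}) coord b i (s b`_k) * coord b k (t b`_j).
  rewrite {1}[t _](coord_vbasis (memvf _)) !linear_sum; apply: eq_bigr => k _.
  by rewrite !linearZ /= mulrC.
by rewrite !coord_comp; congr (_ - _); apply: eq_bigr => k _; rewrite !mxE.
Qed.

End ZeroForm.

(** * Restriction to invariant orthogonal summands *)

Section OrthogonalSplitting.
Variables (F : fieldType) (V : vectType F) (f : {biscalar V}).
Variables P Q : {vspace V}.
Hypotheses (sumPQ : (P + Q = fullv)%VS) (capPQ : (P :&: Q = 0)%VS).
Hypothesis orthPQ : forall u v, u \in P -> v \in Q -> f u v = 0.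
Hypothesis orthQP : forall u v, u \in Q -> v \in P -> f u v = 0.

Let piP := daddv_pi P Q.
Let piQ := daddv_pi Q P.
Let piD v : piP v + piQ v = v.
Proof. by apply: daddv_pi_add; rewrite // sumPQ memvf. Qed.
Let piP_in v : piP v \in P. Proof. exact: memv_pi. Qed.
Let piQ_in v : piQ v \in Q. Proof. exact: memv_pi. Qed.

Lemma splitting_form u v : f u v = f (piP u) (piP v) + f (piQ u) (piQ v).
Proof.
rewrite -{1}[u]piD -{1}[v]piD linearDl !linearDr /=.
rewrite (orthPQ (piP_in u) (piQ_in v)) (orthQP (piQ_in u) (piP_in v)).
by rewrite addr0 add0r.
Qed.

Hypothesis invP : forall y, skew_adjoint f y -> forall u, u \in P -> y u \in P.
Hypothesis invQ : forall y, skew_adjoint f y -> forall u, u \in Q -> y u \in Q.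

Definition restrict_end (W : {vspace V}) (y : 'End(V)) : 'End(subvs_of W) :=
  linfun (vsproj W \o y \o vsval).

Lemma restrict_endE (W : {vspace V}) (y : 'End(V)) u : (forall v, v \in W -> y v \in W) ->
  vsval (restrict_end W y u) = y (vsval u).
Proof. by move=> invW; rewrite lfunE /= vsprojK // invW // subvsP. Qed.

Lemma restrict_end_skew (W : {vspace V}) (y : 'End(V)) : (forall v, v \in W -> y v \in W) ->
  skew_adjoint f y -> restrict_end W y \in form_lie_space (restrict_form f W).
Proof.
move=> invW sky; apply/form_lie_spaceP => u v.
by rewrite /= /restrict_form !restrict_endE // sky.
Qed.

Let LP := form_lie (restrict_form f P).
Let LQ := form_lie (restrict_form f Q).

Definition splitting_map (y : form_lie f) : (LP * LQ)%type :=
  (Subvs (restrict_end_skew (invP (form_lieP y)) (form_lieP y)) : LP,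
   Subvs (restrict_end_skew (invQ (form_lieP y)) (form_lieP y)) : LQ).

Lemma splitting_map1 y u : vsval (vsval (splitting_map y).1 u) = vsval y (vsval u).
Proof. exact: restrict_endE (invP (form_lieP y)). Qed.

Lemma splitting_map2 y u : vsval (vsval (splitting_map y).2 u) = vsval y (vsval u).
Proof. exact: restrict_endE (invQ (form_lieP y)). Qed.

Lemma splitting_ext (s t : (LP * LQ)%type) :
  (forall u, vsval s.1 u = vsval t.1 u) -> (forall u, vsval s.2 u = vsval t.2 u) ->
  s = t.
Proof.
case: s t => [s1 s2] [t1 t2] /= eq1 eq2.
by congr pair; apply/val_inj/lfunP.
Qed.

Fact splitting_map_linear : linear splitting_map.
Proof.
move=> a y z; apply: splitting_ext => u; apply: val_inj.
  rewrite [LHS]splitting_map1 /= !lfunE /= !lfunE /= lfunE /=.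
  by rewrite !vsprojK // invP ?subvsP //; apply: form_lieP.
rewrite [LHS]splitting_map2 /= !lfunE /= !lfunE /= lfunE /=.
by rewrite !vsprojK // invQ ?subvsP //; apply: form_lieP.
Qed.

HB.instance Definition _ := GRing.isLinear.Build F (form_lie f)
  (LP * LQ)%type *:%R splitting_map splitting_map_linear.

(** An element of L(f) is determined by its restrictions. Conversely a pair (s, t)
    is glued along the projections; the result is skew because f is the sum of
    its restrictions to P and Q. *)
Lemma splitting_isomorphic : lie_isomorphic (form_lie f) (LP * LQ)%type.
Proof.
exists splitting_map; split.
  apply: injective_surjective_bij => [y z eq_yz|[s t]].
    apply/val_inj/lfunP => v; rewrite -[v]piD !linearD; congr (_ + _).
      have := splitting_map1 y (vsproj P (piP v)).
      by rewrite eq_yz splitting_map1 vsprojK.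
    have := splitting_map2 y (vsproj Q (piQ v)).
    by rewrite eq_yz splitting_map2 vsprojK.
  pose y0 v := vsval (vsval s (vsproj P (piP v))) + vsval (vsval t (vsproj Q (piQ v))).
  have y_lin : linear y0.
    by move=> a u v; rewrite /y0 !linearP /= scalerDr addrACA.
  have [y yE] := lfun_of_linear y_lin.
  have piPP u : u \in P -> piP u = u by apply: daddv_pi_id.
  have piQQ u : u \in Q -> piQ u = u by apply: daddv_pi_id; rewrite capvC.
  have piPQ u : u \in Q -> piP u = 0.
    by move=> uQ; apply: (addIr u); rewrite -{2}(piQQ u uQ) piD add0r.
  have piQP u : u \in P -> piQ u = 0.
    by move=> uP; apply: (addrI u); rewrite -{1}(piPP u uP) piD addr0.
  have yP (u : subvs_of P) : y (vsval u) = vsval (vsval s u).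
    by rewrite yE /y0 piPP ?piQP ?subvsP // vsvalK !linear0 addr0.
  have yQ (u : subvs_of Q) : y (vsval u) = vsval (vsval t u).
    by rewrite yE /y0 piQQ ?piPQ ?subvsP // vsvalK !linear0 add0r.
  have sky : skew_adjoint f y.
    have invyP u : u \in P -> y u \in P.
      by move=> uP; rewrite -(vsprojK uP) yP subvsP.
    have invyQ u : u \in Q -> y u \in Q.
      by move=> uQ; rewrite -(vsprojK uQ) yQ subvsP.
    have yPi v : piP (y v) = y (piP v).
      rewrite -{1}[v]piD !linearD /= (piPP _ (invyP _ (piP_in v))).
      by rewrite (piPQ _ (invyQ _ (piQ_in v))) addr0.
    have yQi v : piQ (y v) = y (piQ v).
      rewrite -{1}[v]piD !linearD /= (piQQ _ (invyQ _ (piQ_in v))).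
      by rewrite (piQP _ (invyP _ (piP_in v))) add0r.
    move=> u v; rewrite splitting_form [f u _]splitting_form !yPi !yQi opprD.
    congr (_ + _).
      have := form_lieP s (vsproj P (piP u)) (vsproj P (piP v)).
      by rewrite /= /restrict_form -!yP !vsprojK.
    have := form_lieP t (vsproj Q (piQ u)) (vsproj Q (piQ v)).
    by rewrite /= /restrict_form -!yQ !vsprojK.
  have y_in : y \in form_lie_space f by apply/form_lie_spaceP.
  exists (Subvs y_in); apply: splitting_ext => u; apply: val_inj.
    by rewrite [LHS]splitting_map1 yP.
  by rewrite [LHS]splitting_map2 yQ.
move=> y z; apply: splitting_ext => u; apply: val_inj.
  rewrite [LHS]splitting_map1 form_lieE; symmetry.
  transitivity (vsval (vsval (lie (splitting_map y).1 (splitting_map z).1) u)); first by [].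
  rewrite form_lieE linearB; congr (_ - _).
    by rewrite [LHS]splitting_map1; congr (vsval y _); apply: splitting_map1.
  by rewrite [LHS]splitting_map1; congr (vsval z _); apply: splitting_map1.
rewrite [LHS]splitting_map2 form_lieE; symmetry.
transitivity (vsval (vsval (lie (splitting_map y).2 (splitting_map z).2) u)); first by [].
rewrite form_lieE linearB; congr (_ - _).
  by rewrite [LHS]splitting_map2; congr (vsval y _); apply: splitting_map2.
by rewrite [LHS]splitting_map2; congr (vsval z _); apply: splitting_map2.
Qed.

End OrthogonalSplitting.

(** * Invariance of the even and non-degenerate parts *)

(** Transposing J_n and reversing the basis gives J_n again. *)
Lemma jordan_chain_flip (F : fieldType) (V : vectType F) (f : {biscalar V})
    (W : {vspace V}) n e : (0 < n)%N ->
  jordan_chain f W n e -> jordan_chain (flip_form f) W n (fun i => e (n.-1 - i)%N).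
Proof.
move=> n_gt0 che; have lt_rev i : (n.-1 - i < n)%N by lia.
split=> [i lti||i j lti ltj|w wW|w wW|i w lti wW]; rewrite /= /flip_form ?subn0.
- exact: (chain_mem che).
- case: n n_gt0 che {lt_rev} => [|[|n]] // _ che; first exact: chain_neq0 che.
  apply/eqP => /= en0; have := chain_gram che (leqnn n.+2) (leqW (leqnn n.+1)).
  by rewrite en0 linear0l eqxx => /eqP; rewrite eq_sym oner_eq0.
- by rewrite (chain_gram che) //; congr (_ %:R); congr nat_of_bool; lia.
- exact: (chain_top che).
- by rewrite subnn (chain_bottom che).
- have -> : (n.-1 - i = (n.-1 - i.+2).+2)%N by lia.
  by rewrite (chain_step che) //; lia.
Qed.

(** When n is even, i and n - 1 - i have opposite parity: a vector at an even
    position is reached from the bottom of the chain, and one at an odd position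
    from the top, that is, from the bottom of the reversed chain. *)
Lemma even_chain_descends (F : fieldType) (V : vectType F) (f : {biscalar V}) n e i :
    jordan_chain f {:V} n e -> ~~ odd n -> (i < n)%N ->
  exists k, descends f k (e i) \/ descends (flip_form f) k (e i).
Proof.
move=> che even_n lti; have n_gt0 : (0 < n)%N := leq_ltn_trans (leq0n i) lti.
have [odd_i|even_i] := boolP (odd i).
  exists ((n.-1 - i)./2).+1; right.
  have evenS : ~~ odd (n.-1 - i) by rewrite oddB; lia.
  have -> : e i = e (n.-1 - (n.-1 - i)./2.*2)%N by rewrite even_halfK // subKn //; lia.
  apply: (chain_descends (jordan_chain_flip n_gt0 che)).
  by rewrite even_halfK //; lia.
exists (i./2).+1; left; rewrite -[in e i](even_halfK even_i).
by apply: chain_descends che _; rewrite even_halfK.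
Qed.

(** The intended p is the projection onto a non-degenerate orthogonal summand: the
    components of a descending vector are again related step by step, starting
    from 0, and non-degeneracy propagates the vanishing upwards. *)
Lemma descends_orthogonal_nondegenerate (F : fieldType) (V : vectType F)
    (g : {biscalar V}) (p : 'End(V)) k v :
    (forall v w, g (p v) w = g v (p w)) ->
    (forall v, (forall w, g (p v) w = 0) -> p v = 0) ->
  descends g k v -> p v = 0.
Proof.
move=> adj nondeg; elim: k v => [v ->|k IH v [u vu ku]]; first exact: linear0.
by apply: nondeg => w; rewrite adj vu adj IH // linear0r.
Qed.

Section Decomposition.
Variables (F : fieldType) (V : vectType F) (f : {biscalar V}).
Variables (m : nat) (U : 'I_m -> {vspace V}).
Hypothesis sumU : orthogonal_sum f {:V}%VS U.
Hypothesis indecU : forall i, indecomposable f (U i).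

Lemma orthogonal_components (S : pred 'I_m) v :
    v \in (\sum_(i < m | S i) U i)%VS ->
  exists2 vs : 'I_m -> V, forall i, S i -> vs i \in U i &
    v = \sum_(i | S i) vs i /\
    forall i u, S i -> u \in U i -> f v u = f (vs i) u /\ f u v = f u (vs i).
Proof.
have [_ _ orthU] := sumU.
move=> /memv_sumP[vs vsU ->]; exists vs => //; split=> // i u Si uU.
have orthj j : S j && (j != i) -> f (vs j) u = 0 /\ f u (vs j) = 0.
  move=> /andP[Sj ji]; have vsj := vsU j Sj.
  by split; [apply: (orthU j i) | apply: (orthU i j); rewrite // eq_sym].
rewrite linear_sumlz linear_sumr !(bigD1 i Si) /=.
by rewrite !big1 ?addr0 // => j /orthj[].
Qed.

(** The relations hold inside a block by inspection of J_n, and orthogonality to the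
    other blocks extends them to V. *)
Lemma jordan_block_chain n i : has_jordan_gram f n (U i) ->
  (0 < n)%N /\ exists e, [/\ jordan_chain f {:V} n e,
    forall a, (a < n)%N -> e a \in U i &
    forall u, u \in U i -> exists k : 'I_n -> F, u = \sum_j k j *: e j].
Proof.
move=> [X [basX /matrixP gramX]].
have gram a b : (a < n)%N -> (b < n)%N -> f X`_a X`_b = (a == b.+1)%:R.
  by move=> lta ltb; have := gramX (Ordinal lta) (Ordinal ltb); rewrite !mxE.
have [Ui0 _] := indecU i.
have n_gt0 : (0 < n)%N by rewrite -(size_basis basX) lt0n dimv_eq0.
have XU a : (a < n)%N -> X`_a \in U i.
  by move=> lta; rewrite (basis_mem basX) // mem_nth // size_tuple.
split=> //; exists (fun k => X`_k); split=> //; last first.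
  move=> u uU; exists (fun j => coord X j u).
  exact: (coord_basis basX uU).
have expand w : exists k : 'I_n -> F, forall a, (a < n)%N ->
    f X`_a w = \sum_j k j * (a == j.+1)%:R /\
    f w X`_a = \sum_j k j * (j == a.+1 :> nat)%:R.
  have wV : w \in (\sum_(i < m | xpredT i) U i)%VS by have [sU _ _] := sumU; rewrite sU memvf.
  have [ws wsU [_ wsE]] := orthogonal_components wV.
  exists (fun j => coord X j (ws i)) => a lta.
  have [-> ->] := wsE i _ isT (XU a lta).
  have ws_i := coord_basis basX (wsU i isT).
  split; rewrite {1}ws_i ?linear_sumr ?linear_sumlz; apply: eq_bigr => j _.
    by rewrite linearZr_LR gram.
  by rewrite linearZl_LR gram.
split=> [|||w|w|a w lta _].
- by move=> ? _; apply: memvf.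
- have := coord_free (Ordinal n_gt0) (Ordinal n_gt0) (basis_free basX).
  by rewrite eqxx /=; apply: contra_eqN => /eqP->; rewrite linear0 eq_sym oner_neq0.
- exact: gram.
- by have [k kE] := expand w; have [-> _] := kE 0 n_gt0; rewrite big1 // => j _; rewrite mulr0.
- have [k kE] := expand w; have [|_ ->] := kE n.-1; first by rewrite prednK.
  by rewrite prednK // big1 // => j _; rewrite ltn_eqF // mulr0.
- have [k kE] := expand w; have [-> _] := kE _ lta.
  by have [_ ->] := kE _ (ltnW (ltnW lta)); apply: eq_bigr => j _; rewrite eqSS eq_sym.
Qed.

Lemma Vndeg_nondegenerate : left_nondegenerate f (Vndeg f U).
Proof.
move=> q /orthogonal_components[qs qsU [def_q qE]] q0.
rewrite def_q big1 // => i Si.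
have /asboolP noJ := Si.
have noJ' n : ~ has_jordan_gram f n (U i) by move=> hJ; apply: noJ; exists n.
apply: (indecomposable_nondegenerate (indecU i) noJ'); first exact: qsU.
move=> u uU; have [<- _] := qE i u Si uU; apply: q0.
exact: subvP (sumv_sup i Si (subvv _)) _ uU.
Qed.

Hypothesis Vodd0 : Vodd f U = 0%VS.

Lemma no_odd_block i n : odd n -> ~ has_jordan_gram f n (U i).
Proof.
move=> oddn hJ; have [/eqP Ui0 _] := indecU i; apply: Ui0.
apply/eqP; rewrite -subv0 -Vodd0 /Vodd (sumv_sup i) //.
by apply/asboolP; exists n.
Qed.

Lemma even_or_ndeg i :
  `[< ~ exists n, has_jordan_gram f n (U i) >]
  = ~~ `[< exists n, ~~ odd n /\ has_jordan_gram f n (U i) >].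
Proof.
rewrite -asbool_neg; apply/asboolP/asboolP => noJ [n].
  by move=> [_ hJ]; apply: noJ; exists n.
move=> hJ; apply: noJ; exists n; split=> //; apply/negP => oddn.
exact: no_odd_block oddn hJ.
Qed.

Lemma even_ndeg_sum : (Veven f U + Vndeg f U = fullv)%VS.
Proof.
have [sU _ _] := sumU; rewrite -sU [RHS](bigID (fun i =>
  `[< exists n, ~~ odd n /\ has_jordan_gram f n (U i) >])) /=.
by congr (_ + _)%VS; apply: eq_bigl => i; rewrite even_or_ndeg.
Qed.

Lemma even_ndeg_orthogonal u v :
  u \in Veven f U -> v \in Vndeg f U -> f u v = 0 /\ f v u = 0.
Proof.
have [_ _ orthU] := sumU.
move=> /memv_sumP[us usU ->] /memv_sumP[vs vsU ->].
rewrite !linear_sumlz; split; rewrite big1 // => i Si; rewrite linear_sumr big1 // => j Sj.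
  apply: (orthU i j); rewrite ?usU ?vsU //.
  by apply: contraTneq Sj => <-; rewrite even_or_ndeg negbK.
apply: (orthU i j); rewrite ?usU ?vsU //.
by apply: contraTneq Si => ->; rewrite even_or_ndeg negbK.
Qed.

Lemma even_ndeg_cap : (Veven f U :&: Vndeg f U = 0)%VS.
Proof.
apply/eqP; rewrite -subv0; apply/subvP => v /memv_capP[vE vN].
rewrite memv0; apply/eqP/(Vndeg_nondegenerate vN) => w wN.
by have [] := even_ndeg_orthogonal vE wN.
Qed.

Let piE := daddv_pi (Veven f U) (Vndeg f U).
Let piN := daddv_pi (Vndeg f U) (Veven f U).

Let piD v : piE v + piN v = v.
Proof. by apply: daddv_pi_add; [exact: even_ndeg_cap | rewrite even_ndeg_sum memvf]. Qed.
Let piE_in v : piE v \in Veven f U. Proof. exact: memv_pi. Qed.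
Let piN_in v : piN v \in Vndeg f U. Proof. exact: memv_pi. Qed.

Let piN_adjoint v w : f (piN v) w = f v (piN w).
Proof.
rewrite -{1}[w]piD -{2}[v]piD linearDr linearDl /=.
by have [-> _] := even_ndeg_orthogonal (piE_in v) (piN_in w);
  have [_ ->] := even_ndeg_orthogonal (piE_in w) (piN_in v).
Qed.

(** A basis vector of an even block is descending for f or for its transpose, hence
    so is its image under y, which then has no component in V_ndeg. *)
Lemma skew_preserves_even y : skew_adjoint f y ->
  forall u, u \in Veven f U -> y u \in Veven f U.
Proof.
move=> sky u /memv_sumP[us usU ->]; rewrite linear_sum memv_suml // => i Si.
have /asboolP[n [even_n hJ]] := Si.
have [_ [e [che eU spanU]]] := jordan_block_chain hJ.
have [k ->] := spanU _ (usU i Si).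
suff piN0 (j : 'I_n) : piN (y (e j)) = 0.
  rewrite linear_sum memv_suml // => j _; rewrite linearZ; apply: memvZ.
  have yE : piE (y (e j)) = y (e j) by rewrite -[RHS]piD piN0 addr0.
  by have := piE_in (y (e j)); rewrite yE.
have [l [dj|dj]] := even_chain_descends che even_n (ltn_ord j).
  apply: (descends_orthogonal_nondegenerate piN_adjoint _ (descends_skew sky dj)).
  move=> v v0; apply: Vndeg_nondegenerate => // w _; exact: v0.
apply: (@descends_orthogonal_nondegenerate _ _ (flip_form f) piN l).
- by move=> v w; rewrite /= /flip_form piN_adjoint.
- move=> v v0; have /nondegenerate_sym := Vndeg_nondegenerate; apply=> // w _.
  exact: v0.
- apply: descends_skew dj => v w; rewrite /= /flip_form.
  by rewrite sky opprK.
Qed.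

(** An even block has length at least 2, so each coordinate along it is one of the
    forms f(e_j, .) or f(., e_j). *)
Lemma even_biradical0 b : b \in Veven f U ->
  (forall v, f b v = 0) -> (forall v, f v b = 0) -> b = 0.
Proof.
move=> /orthogonal_components[bs bsU [def_b bE]] bl br.
rewrite def_b big1 // => i Si.
have /asboolP[n [even_n hJ]] := Si.
have [n_gt0 [e [che eU spanU]]] := jordan_block_chain hJ.
case: n n_gt0 even_n hJ e che eU spanU => [//|[//|n]] _ _ hJ e che eU spanU.
have [k def_bi] := spanU _ (bsU i Si).
rewrite def_bi big1 // => j _; rewrite -(chain_coord_sum che k j) -def_bi /chain_coord.
case: ifP => [_|neqj].
  have enU := eU n (leqW (leqnn _)).
  by have [<- _] := bE i (e n) Si enU; rewrite bl scale0r.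
have ejU : e j.+1 \in U i by rewrite eU // ltn_neqAle eqSS neqj ltn_ord.
by have [_ <-] := bE i (e j.+1) Si ejU; rewrite br scale0r.
Qed.

(** For w in V_even, f(y u, w) = - f(u, y w) = 0 because y w is again in V_even; the
    same holds on the other side. So the V_even component of y u is orthogonal
    to everything. *)
Lemma skew_preserves_ndeg y : skew_adjoint f y ->
  forall u, u \in Vndeg f U -> y u \in Vndeg f U.
Proof.
move=> sky u uN; suff piE0 : piE (y u) = 0 by rewrite -[y u]piD piE0 add0r.
have E0 w : w \in Veven f U -> f (piE (y u)) w = 0 /\ f w (piE (y u)) = 0.
  move=> wE; have -> : piE (y u) = y u - piN (y u) by rewrite -{2}[y u]piD addrK.
  have [u0 u0'] := even_ndeg_orthogonal (skew_preserves_even sky wE) uN.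
  have [n0 n0'] := even_ndeg_orthogonal wE (piN_in (y u)).
  rewrite linearBl linearBr /= n0 n0' !subr0 sky u0' oppr0; split=> //.
  by apply/eqP; rewrite -oppr_eq0 -sky u0.
apply: even_biradical0 => // v; rewrite -[v]piD ?linearDl ?linearDr /=.
  have [-> _] := E0 _ (piE_in v).
  by have [-> _] := even_ndeg_orthogonal (piE_in (y u)) (piN_in v); rewrite addr0.
have [_ ->] := E0 _ (piE_in v).
by have [_ ->] := even_ndeg_orthogonal (piE_in (y u)) (piN_in v); rewrite addr0.
Qed.

Lemma even_ndeg_isomorphic :
  lie_isomorphic (form_lie f)
    (form_lie (restrict_form f (Veven f U)) * form_lie (restrict_form f (Vndeg f U)))%type.
Proof.
apply: splitting_isomorphic.
- exact: even_ndeg_sum.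
- exact: even_ndeg_cap.
- by move=> u v uE vN; have [] := even_ndeg_orthogonal uE vN.
- by move=> u v uN vE; have [] := even_ndeg_orthogonal vE uN.
- exact: skew_preserves_even.
- exact: skew_preserves_ndeg.
Qed.

End Decomposition.

(** * The main equivalence *)

Theorem proposition4p4 (F : fieldType) (V : vectType F) (f : {biscalar V})
    (m : nat) (U : 'I_m -> {vspace V})
    (charF : 2%N \notin [pchar F])
    (Vneq0 : {:V}%VS != 0%VS)
    (sumU : orthogonal_sum f {:V}%VS U)
    (indecU : forall i, indecomposable f (U i)) :
  let Leven := form_lie (restrict_form f (Veven f U)) in
  let Lndeg := form_lie (restrict_form f (Vndeg f U)) in
  [/\ reductive (form_lie f) <->
        ((forall u v, f u v = 0)
         \/ [/\ Vodd f U = 0%VS, reductive Leven & reductive Lndeg]),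
      (forall u v, f u v = 0) ->
        lie_isomorphic (form_lie f) 'M[F]_(\dim {:V})
    & [/\ Vodd f U = 0%VS, reductive Leven & reductive Lndeg] ->
        lie_isomorphic (form_lie f) (Leven * Lndeg)%type].
Proof.
have iso := even_ndeg_isomorphic sumU indecU.
split; last by case=> Vodd0 _ _; apply: iso.
  split=> [red|]; last first.
    case=> [f0|[Vodd0 redE redN]]; apply: reductive_isomorphic.
    - exact: zero_form_lie_isomorphic.
    - exact: reductive_mx.
    - exact: iso.
    - exact: reductive_sum.
  have [f0|fneq0] := pselect (forall u v, f u v = 0); [by left | right].
  have {fneq0}[u [v fuv]] : exists u v, f u v != 0.
    apply: contrapT => nof; apply: fneq0 => u v; apply/eqP/negP => /negP fuv.
    by apply: nof; exists u, v.
  have Vodd0 : Vodd f U = 0%VS.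
    rewrite /Vodd big_pred0 // => i; apply/asboolP => -[n [oddn hJ]].
    have [_ [e [che _ _]]] := jordan_block_chain sumU indecU hJ.
    case: n oddn {hJ} che => [//|[_|n oddn]] che.
      apply: (radical_not_reductive (chain_neq0 che)) red; last by exists u, v.
        by move=> w; apply: chain_bottom che _ (memvf w).
      by move=> w; apply: chain_top che _ (memvf w).
    by rewrite /= negbK in oddn; apply: (odd_chain_not_reductive charF oddn che).
  have redEN := reductive_isomorphic (lie_isomorphic_sym (iso Vodd0)) red.
  split=> //; first exact: reductive_suml redEN.
  exact: reductive_sumr redEN.
exact: zero_form_lie_isomorphic.
Qed.
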